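(* Let $m\ge 2$ be a fixed integer, let $(X_i)_{i\in\mathbb N}$ be i.i.d. $[0,\infty)$-valued random weights, let $X_1'$ be an independent copy of $X_1$, and let $g^{\neq}\colon[0,\infty)^2\to[0,\infty)$ (symmetric) and $g^{=}\colon[0,\infty)\to[0,\infty)$ be measurable functions. Suppose that $$0<\mathbb E_X\big[g^{\neq}(X_1,X_1')\big]<\infty,\qquad 0\le \mathbb E_X\big[g^{=}(X_1)\big]<\infty,\qquad k^{-2}\sum_{i=1}^k g^{\neq}(X_i,X_i)\xrightarrow[k\to\infty]{}0\ \text{ in probability}.$$ Put $q^{\neq}=\mathbb E_X[g^{\neq}(X_1,X_1')]$, $q^{=}=\mathbb E_X[g^{=}(X_1)]$, $p^{\neq}=1-e^{-q^{\neq}}$, $p^{=}=1-e^{-\frac12(q^{\neq}+q^{=})}$ and $p=(p^{\neq},p^{=})$. For integers $L\ge\ell\ge 1$, let $P(G^{(\ell)}[X])$ be the law, conditional on the weights $X$, of the graph obtained after $\ell$ renormalisations of the inhomogeneous random graph on $[m^L]$ with weights $X$ and rescaled connection functions $\mathfrak g^{\neq}_\ell=m^{-2\ell}g^{\neq}$, $\mathfrak g^{=}_\ell=m^{-\ell}g^{=}$, and let $P(G_{\ell,p})$ be the law of the homogeneous Erdős–Rényi random graph on $m^{L-\ell}$ vertices with edge probability $p^{\neq}$ and self-loop probability $p^{=}$. Then $$\lim_{\ell\to\infty}\ \sup_{L\ge\ell}\ \mathbb E_X\Big[\Delta\big(P(G^{(\ell)}[X]),P(G_{\ell,p})\big)\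Big]=0.$$
   Context: Inhomogeneous random graph. Given weights $X=(X_i)$ and connection functions $g^{\neq}\colon[0,\infty)^2\to[0,\infty)$ (symmetric) and $g^{=}\colon[0,\infty)\to[0,\infty)$, the inhomogeneous random graph on $[n]=\{1,\dots,n\}$ is defined as follows. Conditionally on $X$, all edges and self-loops are drawn independently; the unordered pair $\{i,j\}$, $i\neq j$, is connected by a single edge with probability $1-e^{-g^{\neq}(X_i,X_j)}$, and vertex $i$ carries a single self-loop with probability $1-e^{-\frac12[g^{\neq}(X_i,X_i)+g^{=}(X_i)]}$. (The rescaled connection functions $\mathfrak g^{\neq}_\ell,\mathfrak g^{=}_\ell$ replace $g^{\neq},g^{=}$ in both formulas.) The weights $X_1,\dots,X_n$ are the first $n$ terms of a fixed infinite i.i.d. sequence. $\mathbb E_X$ is expectation with respect to the weights. Renormalisation. Let $n=m^L$. One renormalisation step partitions the vertices into disjoint groups of $m$ vertices and aggregates each group into one vertex. Two distinct aggregated vertices are connected by a single edge if and only if at least one edge connects a constituent of one to a constituent of the other; an aggregated vertex has a single self-loop if and only if there is an edge between two distinct constituents or a self-loop at some constituent. After $\ell$ steps ($0\le\ell\le L$) one obtains a graph $G^{(\ell)}$ on $N_{L-\ell}=m^{L-\ell}$ level-$\ell$ vertices, each a block of $m^\ell$ original vertices. (The partition is fixed and does not depend on the weights.) Homogeneous Erdős–Rényi random graph with parameters $p=(p^{\neq},p^{=})$: all edges between distinct vertices are present independently with probability $p^{\neq}$, and all self-loops independently with probability $p^{=}$. Specific relative entropies. Let $P_f,P_{f'}$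 be two laws of random graphs on $N$ vertices with independent edges and self-loops, where $f_{ij}$, $f'_{ij}$ ($i<j$) are the edge probabilities and $f_{ii}$, $f'_{ii}$ the self-loop probabilities. With $h(u,v)=u\log\frac uv+(1-u)\log\frac{1-u}{1-v}$ (and $0\log 0=0$), $$S^{\neq}(P_f\mid P_{f'})=\binom N2^{-1}\sum_{1\le i<j\le N}h(f_{ij},f'_{ij}),\qquad S^{=}(P_f\mid P_{f'})=N^{-1}\sum_{1\le i\le N}h(f_{ii},f'_{ii}),$$ $$\Delta(P_f,P_{f'})=S^{\neq}(P_f\mid P_{f'})+S^{=}(P_f\mid P_{f'}).$$ When $N=1$ there are no edges and $S^{\neq}$ is taken to be $0$. *)

(* Defs.v *)
From HB Require Import structures.
From mathcomp Require Import all_boot all_order all_algebra.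
From mathcomp Require Import all_classical all_reals all_analysis.

Set Implicit Arguments.
Unset Strict Implicit.
Unset Printing Implicit Defensive.

Import Order.TTheory GRing.Theory Num.Theory.
Import numFieldNormedType.Exports.

Local Open Scope classical_set_scope.
Local Open Scope ring_scope.

Definition independent_pair d (T : measurableType d) (R : realType)
    (P : probability T R) (X Y : T -> R) : Prop :=
  forall A B : set R, measurable A -> measurable B ->
    P (X @^-1` A `&` Y @^-1` B) = (P (X @^-1` A) * P (Y @^-1` B))%E.

(** Mutual independence: the product rule over every finite subfamily. *)
Definition independent_seq d (T : measurableType d) (R : realType)
    (P : probability T R) (X : nat -> T -> R) : Prop :=
  forall (s : seq nat) (A : nat -> set R), uniq s ->
    (forall i, measurable (A i)) ->
    P (\bigcap_(i in [set` s]) X i @^-1` A i)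
      = (\prod_(i <- s) P (X i @^-1` A i))%E.

Definition same_distribution d (T : measurableType d) (R : realType)
    (P : probability T R) (X Y : T -> R) : Prop :=
  forall A : set R, measurable A -> P (X @^-1` A) = P (Y @^-1` A).

Definition iid d (T : measurableType d) (R : realType)
    (P : probability T R) (X : nat -> T -> R) : Prop :=
  independent_seq P X /\ forall i, same_distribution P (X i) (X 0).

Definition cvg_in_probability d (T : measurableType d) (R : realType)
    (P : probability T R) (Y : nat -> T -> R) (Z : T -> R) : Prop :=
  forall eps : R, 0 < eps ->
    P [set w | eps <= `|Y k w - Z w|] @[k --> \oo] --> 0%E.

(** An unordered pair {i, j} (possibly i = j) is encoded by its ordered
    representative with i <= j; (i, i) is the self-loop at i. *)
Definition edge (N : nat) := {e : 'I_N * 'I_N | (e.1 <= e.2)%N}.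

Definition graph (N : nat) := {set edge N}.

Definition adj N (G : graph N) (i j : 'I_N) : bool :=
  [exists e in G, (val e == (i, j)) || (val e == (j, i))].

(** Aggregation along pi.  For a = b the right-hand side covers both the
    edges inside the block a and the self-loops of its constituents. *)
Definition aggregate N N' (pi : 'I_N -> 'I_N') (G : graph N) : graph N' :=
  [set e : edge N' | [exists i, exists j,
    [&& pi i == (val e).1, pi j == (val e).2 & adj G i j]]]%SET.

(** The l-fold renormalisation, for l <= L: blk k groups the m^(k+1) vertices
    of a graph into m^k blocks.  The recursion is on both L and l so that
    the size m^(L - l) computes; only the steps blk (L-1), ..., blk (L-l)
    are used. *)
Fixpoint renormalise (m : nat)
    (blk : forall k, 'I_(m ^ k.+1) -> 'I_(m ^ k)) (L l : nat) {struct L} :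
    graph (m ^ L) -> graph (m ^ (L - l)) :=
  match L, l return graph (m ^ L) -> graph (m ^ (L - l)) with
  | L'.+1, l'.+1 => fun G => renormalise blk l' (aggregate (@blk L') G)
  | L'.+1, 0 => fun G => G
  | 0, _ => fun G => G
  end.

(** Probability mass function. *)
Definition graph_law (R : realType) (N : nat) := graph N -> R.

(** f i j is the probability of the edge {i, j} (of the self-loop if i = j). *)
Definition independent_edges_law (R : realType) N (f : 'I_N -> 'I_N -> R) :
    graph_law R N :=
  fun G => \prod_(e : edge N)
    (if e \in G then f (val e).1 (val e).2 else 1 - f (val e).1 (val e).2).

Definition law_image (R : realType) N N' (F : graph N -> graph N')
    (mu : graph_law R N) : graph_law R N' :=
  fun G' => \sum_(G : graph N | F G == G') mu G.

Definition edge_prob (R : realType) N (mu : graph_law R N) (i j : 'I_N) : R :=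
  \sum_(G : graph N | adj G i j) mu G.

Definition irg_law (R : realType) (g_ne : R -> R -> R) (g_eq : R -> R) N
    (x : 'I_N -> R) : graph_law R N :=
  independent_edges_law (fun i j =>
    if i == j then 1 - expR (- (2^-1 * (g_ne (x i) (x i) + g_eq (x i))))
    else 1 - expR (- g_ne (x i) (x j))).

Definition er_law (R : realType) N (p_ne p_eq : R) : graph_law R N :=
  independent_edges_law (fun i j => if i == j then p_eq else p_ne).

Arguments er_law {R} N p_ne p_eq _.

(** Law, given the weights, of the l-times renormalised graph, started on m^L vertices
    carrying the weights x 0, ..., x (m^L - 1), with connection functions
    rescaled by m^(-2l) and m^(-l). *)
Definition renormalised_irg_law (R : realType) (m : nat)
    (blk : forall k, 'I_(m ^ k.+1) -> 'I_(m ^ k))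
    (g_ne : R -> R -> R) (g_eq : R -> R) (L l : nat) (x : nat -> R) :
    graph_law R (m ^ (L - l)) :=
  law_image (@renormalise m blk L l)
    (irg_law (fun s t => m%:R ^- (2 * l) * g_ne s t)
             (fun s => m%:R ^- l * g_eq s)
             (fun i : 'I_(m ^ L) => x i)).

Arguments renormalised_irg_law {R m} blk g_ne g_eq L l x _.

(** Meaningful for u in [0, 1] and v in ]0, 1[.  The convention 0 log 0 = 0 is
    automatic since ln 0 = 0 in the library. *)
Definition h (R : realType) (u v : R) : R :=
  u * ln (u / v) + (1 - u) * ln ((1 - u) / (1 - v)).

(** Laws with independent edges are determined by their edge probabilities;
    for N = 1 the sum is empty (and 'C(1, 2) = 0, 0^-1 = 0), giving 0. *)
Definition S_ne (R : realType) N (mu nu : graph_law R N) : R :=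
  'C(N, 2)%:R^-1 * \sum_(i < N) \sum_(j < N | (i < j)%N)
    h (edge_prob mu i j) (edge_prob nu i j).

Definition S_eq (R : realType) N (mu nu : graph_law R N) : R :=
  N%:R^-1 * \sum_(i < N) h (edge_prob mu i i) (edge_prob nu i i).

Definition Delta (R : realType) N (mu nu : graph_law R N) : R :=
  S_ne mu nu + S_eq mu nu.

(* Main.v *)
Require Import Defs.
From HB Require Import structures.
From mathcomp Require Import all_boot all_order all_algebra.
From mathcomp Require Import all_classical all_reals all_analysis.
From mathcomp Require Import measurable_realfun.
From mathcomp Require Import ring lra zify.

Set Implicit Arguments.
Unset Strict Implicit.
Unset Printing Implicit Defensive.

Import Order.TTheory GRing.Theory Num.Theory.
Import numFieldNormedType.Exports.

Local Open Scope classical_set_scope.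
Local Open Scope ring_scope.

(** A block of level [l] has [M = m ^ l] vertices.  Two blocks [a] and [b] are
    not joined exactly when no edge joins a member of [a] to a member of [b];
    edges are independent and absent with probability [exp (- rate)], so rates
    add up under aggregation.  Hence distinct blocks are joined with
    probability [1 - exp (- Y_ab)], where [Y_ab] is [M ^- 2] times the sum of
    [g_ne (X i) (X j)] over [i] in [a] and [j] in [b], and [a] carries a loop
    with probability [1 - exp (- Z_a)], where [2 Z_a] is the same expression
    for [a = b] plus the average of [g_eq (X i)] over [a]
    ([edge_prob_renormalised]).

    These rates are averages over about [M ^ 2] pairs of independent weights,
    so they concentrate at [q_ne] and at [(q_ne + q_eq) / 2], the rates of the
    limiting homogeneous graph.  The relative entropy of two Bernoulli laws is
    at most their chi-square divergence, hence at most a constant times the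
    distance of their parameters ([h_le_dist]), and on the half-line
    [y |-> exp (- y)] is 1-Lipschitz with oscillation at most 1.  The theorem
    thus follows from a bound on the mean of [|exp (- Y_ab) - exp (- q_ne)|]
    and of its analogue for [Z_a] which sees a block only through its size:
    this is what makes the estimate uniform in [L] ([expect_Delta_le],
    [edge_prob_L1], [loop_prob_L1]).

    Only first moments of the kernel [f] are available.  Truncating [f] at
    height [K] changes the average by at most the tail of the expectation in
    mean.  The truncated average has a variance of order [K ^ 2 / M], because
    two index pairs contribute a covariance only if they share an index, and
    for each pair at most [4 M] of the [M ^ 2] pairs do.  Letting [M] grow and
    then [K] gives convergence in mean ([U_statistic_L1]).

    For the loops, [g_eq] is absorbed into the kernel
    [g_ne x y + g_eq x], summed over the pairs [i <> j] of a block.  What is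
    left over is [M ^- 2] times the sum of [g_eq (X i)], which vanishes in
    mean, and the diagonal [M ^- 2] times the sum of [g_ne (X i) (X i)], which
    vanishes in probability only; this is enough since the difference of
    exponentials is at most 1.  The assumption on the diagonal concerns the
    first [M] weights, and it carries over to an arbitrary block because the
    weights are exchangeable ([exchangeable_sum]). *)

(** * Relative entropy of Bernoulli laws *)

Section relative_entropy.
Variable R : realType.
Implicit Types u v y q : R.

Lemma ln_le_subr1 (x : R) : 0 < x -> ln x <= x - 1.
Proof.
move=> x0; have := expR_ge1Dx (ln x); rewrite lnK ?posrE// => ?; lra.
Qed.

Lemma mul_ln_ge u v : 0 <= u -> 0 < v -> u - v <= u * ln (u / v).
Proof.
move=> u0 v0; have [->|un0] := eqVneq u 0; first by rewrite mul0r sub0r oppr_le0 ltW.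
have up : 0 < u by rewrite lt_neqAle eq_sym un0.
have -> : u / v = (v / u)^-1 by rewrite invf_div.
rewrite lnV ?posrE ?divr_gt0//.
have := ln_le_subr1 (divr_gt0 v0 up) => h1.
have : u * ln (v / u) <= u * (v / u - 1) by rewrite ler_pM2l.
rewrite mulrBr mulr1 mulrCA divff// mulr1; lra.
Qed.

Lemma mul_ln_le u v : 0 <= u -> 0 < v -> u * ln (u / v) <= u * (u / v - 1).
Proof.
move=> u0 v0; have [->|un0] := eqVneq u 0; first by rewrite !mul0r.
have up : 0 < u by rewrite lt_neqAle eq_sym un0.
by rewrite ler_pM2l// ln_le_subr1// divr_gt0.
Qed.

(** The bound [ln x <= x - 1] makes the two terms of [h u v] at least [u - v]
    and [v - u]. *)
Lemma h_ge0 u v : 0 <= u <= 1 -> 0 < v < 1 -> 0 <= h u v.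
Proof.
move=> /andP[u0 u1] /andP[v0 v1]; rewrite /h.
have h1 := mul_ln_ge u0 v0.
have := @mul_ln_ge (1 - u) (1 - v); rewrite !subr_ge0 subr_gt0.
move=> /(_ u1 v1) h2; lra.
Qed.

(** Using [ln x <= x - 1] in both terms bounds [h u v] by the chi-square
    divergence [(u - v) ^ 2 / (v (1 - v))], and [|u - v| <= 1] removes the
    square.  A bound linear in [|u - v|] is what convergence in mean can feed. *)
Lemma h_le_dist u v : 0 <= u <= 1 -> 0 < v < 1 ->
  h u v <= (v * (1 - v))^-1 * `|u - v|.
Proof.
move=> /andP[u0 u1] /andP[v0 v1]; rewrite /h.
have w0 : 0 < 1 - v by rewrite subr_gt0.
have h1 := mul_ln_le u0 v0.
have := @mul_ln_le (1 - u) (1 - v); rewrite subr_ge0 => /(_ u1 w0) h2.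
have chi2 : u * (u / v - 1) + (1 - u) * ((1 - u) / (1 - v) - 1)
    = (v * (1 - v))^-1 * `|u - v| ^+ 2.
  rewrite real_normK ?num_real//; field; rewrite ?gt_eqF//.
apply: (le_trans (lerD h1 h2)); rewrite chi2.
rewrite ler_pM2l ?invr_gt0 ?mulr_gt0// expr2 ler_piMl//.
by rewrite ler_norml; apply/andP; split; lra.
Qed.

Lemma dist_expRN_le y q : 0 <= y -> 0 <= q ->
  `|expR (- y) - expR (- q)| <= `|y - q|.
Proof.
wlog yq : y q / y <= q.
  move=> H y0 q0; have [yq|/ltW qy] := leP y q; first exact: H.
  by rewrite distrC (distrC y); apply: H.
move=> y0 q0; rewrite ger0_norm ?subr_ge0 ?ler_expR ?lerN2//.
rewrite ler0_norm ?subr_le0// opprB.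
have -> : - q = - y + (y - q) by ring.
rewrite expRD -[X in X - _]mulr1 -mulrBr.
have e1 : expR (- y) <= 1 by rewrite -expR0 ler_expR oppr_le0.
have e2 := expR_ge1Dx (y - q).
have e3 : 0 <= 1 - expR (y - q) by rewrite subr_ge0 -expR0 ler_expR subr_le0.
apply: (le_trans (ler_wpM2r e3 e1)); rewrite mul1r; lra.
Qed.

(** This cap is what allows an exponent to be controlled in probability only. *)
Lemma dist_expRN_le1 y q : 0 <= y -> 0 <= q ->
  `|expR (- y) - expR (- q)| <= 1.
Proof.
move=> y0 q0.
have e1 : expR (- y) <= 1 by rewrite -expR0 ler_expR oppr_le0.
have e2 : expR (- q) <= 1 by rewrite -expR0 ler_expR oppr_le0.
have := expR_ge0 (- y); have := expR_ge0 (- q) => ? ?.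
by rewrite ler_norml; apply/andP; split; lra.
Qed.

Lemma subr1_expRN_itv y : 0 <= y -> 0 <= 1 - expR (- y) <= 1.
Proof.
move=> y0; have e1 : expR (- y) <= 1 by rewrite -expR0 ler_expR oppr_le0.
by have := expR_ge0 (- y) => ?; apply/andP; split; lra.
Qed.

Lemma subr1_expRN_oitv y : 0 < y -> 0 < 1 - expR (- y) < 1.
Proof.
move=> y0; have e1 : expR (- y) < 1 by rewrite -expR0 ltr_expR oppr_lt0.
by have := expR_gt0 (- y) => ?; apply/andP; split; lra.
Qed.

End relative_entropy.

(** * Edge probabilities of the renormalised graph *)

Section graph_laws.

Lemma adjC N (G : graph N) i j : adj G i j = adj G j i.
Proof. by apply: eq_existsb => e; rewrite orbC. Qed.

Lemma adj_aggregate N N' (pi : 'I_N -> 'I_N') (G : graph N) a b :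
  adj (aggregate pi G) a b <->
  exists i j, [/\ pi i = a, pi j = b & adj G i j].
Proof.
split.
- move=> /existsP[e /andP[]]; rewrite inE => /existsP[i /existsP[j /and3P[/eqP pi1 /eqP pj2 Gij]]].
  case/orP => /eqP e_ab; first by exists i, j; rewrite pi1 pj2 e_ab.
  by exists j, i; rewrite pi1 pj2 e_ab adjC.
- move=> [i [j [<- <- Gij]]].
  (* The edge of the aggregated graph is the ordered one of the two pairs. *)
have [le_ij|lt_ji] := leqP (pi i) (pi j).
    apply/existsP; exists (exist _ (pi i, pi j) le_ij); rewrite inE /= eqxx andbT.
    by apply/existsP; exists i; apply/existsP; exists j; rewrite !eqxx.
  apply/existsP; exists (exist (fun e : 'I_N' * 'I_N' => (e.1 <= e.2)%N) (pi j, pi i) (ltnW lt_ji)).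
  rewrite inE /= eqxx orbT andbT.
  by apply/existsP; exists j; apply/existsP; exists i; rewrite !eqxx adjC.
Qed.

(** Aggregating in [l] steps is aggregating once along the composite of the
    partitions, whose fibres have [m ^ l] elements.  Adjacency in the
    renormalised graph is thereby expressed in the original one, which avoids
    all intermediate graph laws. *)
Lemma renormalise_aggregate m (blk : forall k, 'I_(m ^ k.+1) -> 'I_(m ^ k))
    (blk_card : forall k (j : 'I_(m ^ k)),
       #|[set i : 'I_(m ^ k.+1) | blk k i == j]%SET| = m) L l : (l <= L)%N ->
  exists pi : 'I_(m ^ L) -> 'I_(m ^ (L - l)),
    (forall a, #|[set i | pi i == a]%SET| = (m ^ l)%N) /\
    (forall (G : graph (m ^ L)) a b, adj (renormalise blk l G) a b <->
       exists i j, [/\ pi i = a, pi j = b & adj G i j]).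
Proof.
have idP N (G : graph N) a b :
    adj G a b <-> exists i j, [/\ id i = a, id j = b & adj G i j].
  by split => [Gab|[i [j [<- <-]]]//]; exists a, b.
have id_card N (a : 'I_N) : #|[set i | id i == a]%SET| = 1%N.
  by rewrite (_ : [set i | id i == a]%SET = [set a]%SET) ?cards1//; apply/setP => i; rewrite !inE.
elim: L l => [|L IH] [|l] //= lL; try by exists id; split=> [a|G a b]; [exact: id_card|exact: idP].
have [pi [pi_card piP]] := IH l lL; exists (pi \o blk L); split=> [a|G a b].
- have fibre j : pi j == a ->
      (\sum_(i in [set i | (pi \o blk L) i == a]%SET | blk L i == j) 1)%N = m.
    move=> /eqP pj; transitivity #|[set i | blk L i == j]%SET|; last exact: blk_card.
    rewrite -sum1_card; apply: eq_bigl => i; rewrite !inE /=.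
    by case: (blk L i =P j) => [->|]; rewrite ?andbF// pj eqxx.
  rewrite -sum1_card (partition_big (blk L) (fun j => pi j == a)) /=; last first.
    by move=> i; rewrite inE.
  rewrite (eq_bigr (fun=> m)); last exact: fibre.
  rewrite sum_nat_const expnSr; congr (_ * _)%N.
  by rewrite -(pi_card a); apply: eq_card => i; rewrite !inE.
- rewrite piP; split.
    move=> [i [j [pia pjb /adj_aggregate[i' [j' [i'i j'j Gij]]]]]].
    by exists i', j'; rewrite /= i'i j'j.
  move=> [i [j [pia pjb Gij]]]; exists (blk L i), (blk L j); split=> //.
  by apply/adj_aggregate; exists i, j.
Qed.

Variable R : realType.

Lemma edge_prob_law_image N N' (F : graph N -> graph N') (mu : graph_law R N) a b :
  edge_prob (law_image F mu) a b = \sum_(G : graph N | adj (F G) a b) mu G.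
Proof.
rewrite [RHS](partition_big F (fun G' => adj G' a b))//=.
apply: eq_bigr => G' Gab; apply: eq_bigl => G.
by case: eqP => [->|]; rewrite ?andbF// Gab.
Qed.

(** Setting the probability of the edges of [E] to zero kills exactly the
    graphs that meet [E]; the sum over all graphs of the remaining products is
    then the expanded product of [0 + (1 - f e)] over [E] and of
    [f e + (1 - f e) = 1] elsewhere. *)
Lemma prob_disjoint N (f : 'I_N -> 'I_N -> R) (E : {set edge N}) :
  \sum_(G : graph N | [disjoint G & E]) independent_edges_law f G =
  \prod_(e in E) (1 - f (val e).1 (val e).2).
Proof.
(* Graphs avoiding [E] have the same weight under [F] as under [f]. *)
pose F (e : edge N) := if e \in E then 0 else f (val e).1 (val e).2.
have /= := @bigA_distr R 0 1 *%R +%R (edge N) F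
  (fun e => 1 - f (val e).1 (val e).2).
rewrite [X in X = _](_ : _ = \prod_(e in E) (1 - f (val e).1 (val e).2)); last first.
  rewrite [RHS]big_mkcond; apply: eq_bigr => e _; rewrite /F.
  by case: ifP => _; rewrite ?add0r// addrC subrK.
move=> ->; rewrite big_mkcond /=; apply: eq_bigr => G _.
case: ifPn => [GE|/pred0Pn[e /= /andP[eG eE]]].
  apply: eq_bigr => e _; case: ifPn => // eG; rewrite /F.
  by rewrite (disjointFr GE eG).
by rewrite (bigD1 e)//= eG /F eE mul0r.
Qed.

Lemma prob_intersect N (f : 'I_N -> 'I_N -> R) (E : {set edge N}) :
  \sum_(G : graph N | ~~ [disjoint G & E]) independent_edges_law f G =
  1 - \prod_(e in E) (1 - f (val e).1 (val e).2).
Proof.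
have := prob_disjoint f finset.set0; rewrite finset.big_set0 => total.
rewrite -(prob_disjoint f E) -total; apply/esym/eqP; rewrite subr_eq; apply/eqP.
have all_disj (G : graph N) : [disjoint G & (finset.set0 : {set edge N})]%B.
  by apply/pred0P => e; rewrite /= inE andbF.
under eq_bigl do rewrite all_disj.
by rewrite (bigID (fun G : graph N => [disjoint G & E]%B))/= addrC.
Qed.

Definition edges_between N N' (pi : 'I_N -> 'I_N') a b : {set edge N} :=
  [set e : edge N | ((pi (val e).1 == a) && (pi (val e).2 == b)) ||
                    ((pi (val e).1 == b) && (pi (val e).2 == a))]%SET.

Lemma edges_betweenP N N' (pi : 'I_N -> 'I_N') a b (G : graph N) :
  (exists i j, [/\ pi i = a, pi j = b & adj G i j]) <->
  ~~ [disjoint G & edges_between pi a b]%B.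
Proof.
split.
- move=> [i [j [pia pjb /existsP[e /andP[eG eij]]]]].
  apply/pred0Pn; exists e => /=; rewrite eG inE.
  by case/orP: eij => /eqP ->; rewrite pia pjb !eqxx ?orbT.
- move=> /pred0Pn[e /= /andP[eG]]; rewrite inE => /orP[|] /andP[/eqP e1 /eqP e2].
    exists (val e).1, (val e).2; split=> //; apply/existsP; exists e.
    by rewrite eG -surjective_pairing eqxx.
  exists (val e).2, (val e).1; split=> //; apply/existsP; exists e.
  by rewrite eG -surjective_pairing eqxx orbT.
Qed.

Lemma edge_prob_blocks N N' (F : graph N -> graph N') (pi : 'I_N -> 'I_N')
    (f : 'I_N -> 'I_N -> R) a b :
  (forall G, adj (F G) a b <-> exists i j, [/\ pi i = a, pi j = b & adj G i j]) ->
  edge_prob (law_image F (independent_edges_law f)) a b =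
  1 - \prod_(e in edges_between pi a b) (1 - f (val e).1 (val e).2).
Proof.
move=> FP; rewrite edge_prob_law_image -prob_intersect; apply: eq_bigl => G.
by apply/idP/idP; rewrite FP edges_betweenP.
Qed.

Lemma edge_swap N (e e' : edge N) x y :
  val e = (x, y) -> val e' = (y, x) -> e = e'.
Proof.
move=> ve ve'; have := valP e; have := valP e'; rewrite ve ve' /= => yx xy.
have xyE : x = y by apply/val_inj/eqP; rewrite eqn_leq xy yx.
by apply: val_inj; rewrite ve ve' xyE.
Qed.

(** The case of the identity partition, where the set of edges to avoid has a
    single element. *)
Lemma edge_prob_er N (p_ne p_eq : R) (a b : 'I_N) :
  edge_prob (er_law N p_ne p_eq) a b = if a == b then p_eq else p_ne.
Proof.
have -> : er_law N p_ne p_eq = law_image id (er_law N p_ne p_eq).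
  by apply/funext => G; rewrite /law_image big_pred1_eq.
rewrite (@edge_prob_blocks _ _ _ id); last first.
  by move=> G; split => [Gab|[i [j [<- <-]]]//]; exists a, b.
have [e ee] : exists e : edge N, (val e = (a, b)) \/ (val e = (b, a)).
  have [le_ab|/ltnW le_ba] := leqP a b.
    by exists (exist (fun e : 'I_N * 'I_N => (e.1 <= e.2)%N) (a, b) le_ab); left.
  by exists (exist (fun e : 'I_N * 'I_N => (e.1 <= e.2)%N) (b, a) le_ba); right.
rewrite (_ : edges_between id a b = [set e]%SET); last first.
  apply/setP => e'; rewrite !inE -!xpair_eqE -surjective_pairing.
  apply/idP/eqP => [|->]; last by case: ee => ->; rewrite eqxx ?orbT.
  case: ee => ve /orP[] /eqP ve'; try by apply: val_inj; rewrite ve ve'.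
    exact: (edge_swap ve' ve).
  exact: (edge_swap ve' ve).
rewrite finset.big_set1 opprB addrC subrK.
by case: ee => ->; rewrite //= eq_sym.
Qed.

Lemma sum_edges N (A : pred ('I_N * 'I_N)) (c : 'I_N -> 'I_N -> R) :
  \sum_(e : edge N | A (val e)) c (val e).1 (val e).2 =
  \sum_(p : 'I_N * 'I_N | (p.1 <= p.2)%N && A p) c p.1 p.2.
Proof.
rewrite [RHS](reindex_omap (val : edge N -> 'I_N * 'I_N) insub) /=; last first.
  by move=> p /andP[p12 _]; rewrite insubT.
by apply: eq_bigl => e; rewrite (valP e) valK eqxx andbT.
Qed.

(** An edge is an ordered representative of an unordered pair.  An unordered
    pair from [A] and [B], disjoint, has exactly one ordering in [A * B], so
    the order constraint disappears. *)
Lemma sum_edges_distinct N (c : 'I_N -> 'I_N -> R) (A B : pred 'I_N) :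
  (forall i j, c i j = c j i) -> (forall i, A i -> B i -> False) ->
  \sum_(e : edge N | (A (val e).1 && B (val e).2) || (B (val e).1 && A (val e).2))
     c (val e).1 (val e).2 = \sum_(i | A i) \sum_(j | B j) c i j.
Proof.
move=> cC AB; have AB' k : ~~ (A k && B k) by apply/negP => /andP[/AB].
rewrite (@sum_edges _ (fun p => (A p.1 && B p.2) || (B p.1 && A p.2))).
rewrite pair_big /= big_mkcond /=.
pose D (x : bool) (p : 'I_N * 'I_N) : R := if x && (A p.1 && B p.2) then c p.1 p.2 else 0.
transitivity (\sum_(p : 'I_N * 'I_N) (D (p.1 <= p.2)%N p + D (p.1 <= p.2)%N (p.2, p.1))).
  apply: eq_bigr => -[i j] _; rewrite /D /= (cC j i).
  case: leqP => _ /=; last by rewrite addr0.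
  have := AB' i; have := AB' j.
  by case: (A i) => /=; case: (A j) => /=; case: (B i) => /=; case: (B j) => //=;
    rewrite ?addr0 ?add0r.
rewrite big_split /=.
rewrite [X in _ + X](reindex (fun p : 'I_N * 'I_N => (p.2, p.1))) /=; last first.
  by exists (fun p : 'I_N * 'I_N => (p.2, p.1)) => -[].
rewrite -big_split /= [RHS]big_mkcond /=; apply: eq_bigr => -[i j] _ /=.
rewrite /D /=; case ABij: (A i && B j); rewrite ?andbT ?andbF ?addr0//.
case: (ltngtP i j) => [||/val_inj ij]; rewrite ?addr0 ?add0r//.
by move: ABij; rewrite ij => /andP[/AB].
Qed.

(** The factor 1/2 in the rate of a loop is chosen for this identity: twice the
    rates of the edges and loops inside a block is a sum over all ordered
    pairs, diagonal included, plus the sum of the loop terms [s]. *)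
Lemma sum_edges_same N (c : 'I_N -> 'I_N -> R) (s : 'I_N -> R) (A : pred 'I_N) :
  (forall i j, c i j = c j i) ->
  \sum_(e : edge N | A (val e).1 && A (val e).2)
     (if (val e).1 == (val e).2 then 2^-1 * (c (val e).1 (val e).1 + s (val e).1)
      else c (val e).1 (val e).2) =
  2^-1 * (\sum_(i | A i) \sum_(j | A j) c i j + \sum_(i | A i) s i).
Proof.
move=> cC; apply: (@mulfI _ 2) => //; rewrite mulrA divff// mul1r.
rewrite (@sum_edges _ (fun p => A p.1 && A p.2)
  (fun i j => if i == j then 2^-1 * (c i i + s i) else c i j)).
rewrite big_mkcond mulr2n mulrDl mul1r.
rewrite [X in _ + X](reindex (fun p : 'I_N * 'I_N => (p.2, p.1))) /=; last first.
  by exists (fun p : 'I_N * 'I_N => (p.2, p.1)) => -[].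
rewrite -big_split /=.
transitivity (\sum_(i | A i) \sum_(j | A j) (c i j + (if i == j then s i else 0))).
  rewrite pair_big /= [RHS]big_mkcond /=; apply: eq_bigr => -[i j] _ /=.
  rewrite (andbC (A j)); case: (A i && A j); rewrite ?andbT ?andbF ?addr0//.
  rewrite (eq_sym j i); case: (ltngtP i j) => [ij|ij|/val_inj ->].
  - by rewrite -val_eqE /= ltn_eqF// !addr0.
  - by rewrite -val_eqE /= gtn_eqF// add0r addr0 cC.
  - by rewrite !eqxx; field.
rewrite (eq_bigr (fun i => \sum_(j | A j) c i j +
    \sum_(j | A j) (if i == j then s i else 0))); last first.
  by move=> i _; rewrite big_split.
rewrite big_split /=; congr (_ + _); apply: eq_bigr => i Ai.
rewrite -big_mkcondr (big_pred1 i)// => j.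
by rewrite andbC [RHS]eq_sym; case: eqP => //= <-.
Qed.

Lemma expRN_sum (I : finType) (A : pred I) (r : I -> R) :
  \prod_(i | A i) expR (- r i) = expR (- \sum_(i | A i) r i).
Proof.
by rewrite -sumrN (big_morph expR (@expRD R) (@expR0 R)).
Qed.

(** Aggregation turns products of the probabilities [exp (- rate)] of absence
    into exponentials of sums of rates.  The partition [pi] is chosen before
    the weights, so that it is the same for all weight configurations. *)
Lemma edge_prob_renormalised m (blk : forall k, 'I_(m ^ k.+1) -> 'I_(m ^ k))
    (blk_card : forall k (j : 'I_(m ^ k)),
       #|[set i : 'I_(m ^ k.+1) | blk k i == j]%SET| = m) L l : (l <= L)%N ->
  exists pi : 'I_(m ^ L) -> 'I_(m ^ (L - l)),
    (forall a, #|[set i | pi i == a]%SET| = (m ^ l)%N) /\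
    (forall (g_ne : R -> R -> R) (g_eq : R -> R) (x : nat -> R) a b,
      (forall i j, g_ne (x i) (x j) = g_ne (x j) (x i)) ->
      edge_prob (renormalised_irg_law blk g_ne g_eq L l x) a b =
      if a == b then
        1 - expR (- (2^-1 *
          (m%:R ^- (2 * l) * \sum_(i | pi i == a) \sum_(j | pi j == a) g_ne (x i) (x j)
           + m%:R ^- l * \sum_(i | pi i == a) g_eq (x i))))
      else
        1 - expR (- (m%:R ^- (2 * l) *
          \sum_(i | pi i == a) \sum_(j | pi j == b) g_ne (x i) (x j)))).
Proof.
move=> lL; have [pi [pi_card piP]] := renormalise_aggregate blk_card lL.
exists pi; split=> // g_ne g_eq x a b gC.
rewrite /renormalised_irg_law /irg_law (edge_prob_blocks _ (fun G => piP G a b)).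
pose c (i j : 'I_(m ^ L)) := m%:R ^- (2 * l) * g_ne (x i) (x j).
pose s (i : 'I_(m ^ L)) := m%:R ^- l * g_eq (x i).
have cC i j : c i j = c j i by rewrite /c gC.
rewrite (eq_bigr (fun e : edge (m ^ L) => expR (-
    (if (val e).1 == (val e).2
     then 2^-1 * (c (val e).1 (val e).1 + s (val e).1)
     else c (val e).1 (val e).2)))); last first.
  by move=> e _; case: ifP => _; rewrite opprB addrC subrK.
rewrite expRN_sum; case: (eqVneq a b) => [<-|ab]; congr (1 - expR (- _)).
  rewrite (eq_bigl (fun e : edge _ => (pi (val e).1 == a) && (pi (val e).2 == a))); last first.
    by move=> e; rewrite inE orbb.
  rewrite (@sum_edges_same _ c s (fun i => pi i == a))// mulr_sumr; congr (_ * (_ + _)).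
    by apply: eq_bigr => i _; rewrite mulr_sumr.
  by rewrite mulr_sumr.
rewrite (eq_big (fun e : edge _ => ((pi (val e).1 == a) && (pi (val e).2 == b)) ||
    ((pi (val e).1 == b) && (pi (val e).2 == a))) (fun e => c (val e).1 (val e).2)); last 2 first.
- by move=> e; rewrite inE.
- move=> e; rewrite inE; case: ((val e).1 =P (val e).2) => // -> /orP[] /andP[/eqP -> /eqP E].
    by rewrite E eqxx in ab.
  by rewrite E eqxx in ab.
rewrite (@sum_edges_distinct _ c (fun i => pi i == a) (fun i => pi i == b))//; last first.
  by move=> i /eqP -> /eqP E; rewrite E eqxx in ab.
by rewrite mulr_sumr; apply: eq_bigr => i _; rewrite mulr_sumr.
Qed.

End graph_laws.

(** * Joint laws of independent variables *)

Section joint_laws.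
Context d (T : measurableType d) (R : realType) (P : probability T R).

Definition rv_pair d1 d2 (T1 : measurableType d1) (T2 : measurableType d2)
  (U : {mfun T >-> T1}) (V : {mfun T >-> T2}) : T -> T1 * T2 :=
  fun w => (U w, V w).

Lemma measurable_rv_pair d1 d2 (T1 : measurableType d1) (T2 : measurableType d2)
    (U : {mfun T >-> T1}) (V : {mfun T >-> T2}) :
  measurable_fun [set: T] (rv_pair U V).
Proof. by apply/measurable_fun_pairP; split; exact: measurable_funP. Qed.

HB.instance Definition _ d1 d2 (T1 : measurableType d1) (T2 : measurableType d2)
    (U : {mfun T >-> T1}) (V : {mfun T >-> T2}) :=
  isMeasurableFun.Build _ _ _ _ (rv_pair U V) (measurable_rv_pair U V).

(** Rectangles form a pi-system that generates the product sigma-algebra. *)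
Lemma measure_unique_setX d1 d2 (T1 : measurableType d1) (T2 : measurableType d2)
    (m1 m2 : {measure set (T1 * T2) -> \bar R}) :
  (m1 setT < +oo)%E ->
  (forall A B, measurable A -> measurable B -> m1 (A `*` B) = m2 (A `*` B)) ->
  forall C, measurable C -> m1 C = m2 C.
Proof.
move=> m1oo m12.
apply: (measure_unique [set A `*` B | A in measurable & B in measurable]
  (fun=> setT)) => //.
- exact: measurable_prod_measurableType.
- move=> _ _ [A mA [B mB <-]] [A' mA' [B' mB' <-]].
  rewrite -setXI; exists (A `&` A'); first exact: measurableI.
  by exists (B `&` B') => //; exact: measurableI.
- by move=> _; exists setT => //; exists setT => //; rewrite setXTT.
- by rewrite bigcup_const.
- by move=> _ [A mA [B mB <-]]; exact: m12.
Qed.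

Lemma measurable_preimage_rv d1 (T1 : measurableType d1) (U : {mfun T >-> T1}) A :
  measurable A -> measurable (U @^-1` A).
Proof. by move=> mA; rewrite -[X in measurable X]setTI; exact: measurable_funP. Qed.

(** Both sides are finite measures in [C], equal on rectangles. *)
Lemma rv_pair_indep_event d1 d2 (T1 : measurableType d1) (T2 : measurableType d2)
    (U : {mfun T >-> T1}) (V : {mfun T >-> T2}) (E : set T) : measurable E ->
  (forall A B, measurable A -> measurable B ->
     P (U @^-1` A `&` V @^-1` B `&` E) = (P (U @^-1` A `&` V @^-1` B) * P E)%E) ->
  forall C, measurable C ->
    P (rv_pair U V @^-1` C `&` E) = (P (rv_pair U V @^-1` C) * P E)%E.
Proof.
move=> mE UVE C mC.
have PE0 : 0 <= fine (P E) by exact: fine_ge0.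
pose m1 : {measure set (T1 * T2) -> \bar R} :=
  measure_function_pushforward__canonical__measure_function_Measure
   (mrestr P mE) (measurable_funP (rv_pair U V)).
pose m2 : {measure set (T1 * T2) -> \bar R} :=
  mscale (NngNum PE0) (distribution P (rv_pair U V)).
have m2E A : m2 A = (P (rv_pair U V @^-1` A) * P E)%E.
  by rewrite -[P E in RHS]fineK ?fin_num_measure// muleC.
rewrite -m2E -[LHS]/(m1 C); apply: measure_unique_setX => //.
  rewrite /m1 /= /pushforward /mrestr preimage_setT setTI.
  by rewrite (le_lt_trans (probability_le1 _ mE))// ltry.
by move=> A B mA mB; rewrite m2E -[LHS]/(P (_ `&` _)) -UVE.
Qed.

Definition indep_rv d1 d2 (T1 : measurableType d1) (T2 : measurableType d2)
    (U : {mfun T >-> T1}) (V : {mfun T >-> T2}) :=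
  forall A B, measurable A -> measurable B ->
    P (U @^-1` A `&` V @^-1` B) = (P (U @^-1` A) * P (V @^-1` B))%E.

(** The pi-lambda argument is applied once per pair, the other pair entering
    as a fixed event. *)
Lemma indep_rv_pair (U1 U2 V1 V2 : {mfun T >-> R}) :
  (forall A1 A2 B1 B2, measurable A1 -> measurable A2 ->
     measurable B1 -> measurable B2 ->
     P ((U1 @^-1` A1 `&` U2 @^-1` A2) `&` (V1 @^-1` B1 `&` V2 @^-1` B2)) =
     (P (U1 @^-1` A1 `&` U2 @^-1` A2) * P (V1 @^-1` B1 `&` V2 @^-1` B2))%E) ->
  indep_rv (rv_pair U1 U2) (rv_pair V1 V2).
Proof.
move=> H A B mA mB; rewrite setIC muleC; apply: rv_pair_indep_event => //.
  exact: measurable_preimage_rv.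
move=> B1 B2 mB1 mB2; rewrite setIC muleC; apply: rv_pair_indep_event => //.
  by apply: measurableI; exact: measurable_preimage_rv.
by move=> A1 A2 mA1 mA2; exact: H.
Qed.

Lemma indep_rv_law d1 d2 (T1 : measurableType d1) (T2 : measurableType d2)
    (U : {mfun T >-> T1}) (V : {mfun T >-> T2}) : indep_rv U V ->
  forall C, measurable C ->
    distribution P (rv_pair U V) C = (distribution P U \x distribution P V)%E C.
Proof.
move=> UV C mC; apply/esym.
by apply: product_measure_unique => // A B mA mB; exact: UV.
Qed.

(** Tonelli on the joint law, which is a product measure. *)
Lemma indep_rv_mul d1 d2 (T1 : measurableType d1) (T2 : measurableType d2)
    (U : {mfun T >-> T1}) (V : {mfun T >-> T2}) (f : T1 -> R) (g : T2 -> R) :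
  indep_rv U V -> measurable_fun setT f -> measurable_fun setT g ->
  (forall x, 0 <= f x) -> (forall x, 0 <= g x) ->
  (\int[P]_w (f (U w) * g (V w))%:E =
   (\int[P]_w (f (U w))%:E) * (\int[P]_w (g (V w))%:E))%E.
Proof.
move=> UV mf mg f0 g0.
pose fg : T1 * T2 -> \bar R := fun z => (f z.1 * g z.2)%:E.
have mfg : measurable_fun setT fg.
  by apply/measurable_EFinP/measurable_funM; exact: measurableT_comp.
transitivity (\int[distribution P (rv_pair U V)]_z fg z)%E.
  by rewrite ge0_integral_distribution// => z; rewrite lee_fin mulr_ge0.
rewrite (eq_measure_integral (distribution P U \x distribution P V)%E); last first.
  by move=> C mC _; exact: indep_rv_law.
rewrite fubini_tonelli1//; last by move=> z; rewrite lee_fin mulr_ge0.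
rewrite /fubini_F /=.
have fE (h : T1 -> R) (W : {mfun T >-> T1}) : measurable_fun setT h -> (forall x, 0 <= h x) ->
   (\int[P]_w (h (W w))%:E = \int[distribution P W]_x (h x)%:E)%E.
  move=> mh h0; rewrite ge0_integral_distribution//.
  exact/measurable_EFinP.
rewrite fE//; rewrite -ge0_integralZr//; last 3 first.
- exact/measurable_EFinP.
- by move=> x _; rewrite lee_fin.
- by apply: integral_ge0 => w _; rewrite lee_fin.
apply: eq_integral => x _.
rewrite /fg /=; under eq_integral do rewrite EFinM.
rewrite ge0_integralZl//; last 3 first.
- exact/measurable_EFinP.
- by move=> y _; rewrite lee_fin.
- by rewrite lee_fin.
by rewrite ge0_integral_distribution//; exact/measurable_EFinP.
Qed.

End joint_laws.

(** * Pairs of i.i.d. weights *)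

Section iid_weights.
Context d (T : measurableType d) (R : realType) (P : probability T R).
Variable X : nat -> {mfun T >-> R}.
Hypothesis X_iid : iid P (fun i => X i : T -> R).

Lemma iid_box (s : seq nat) (A : nat -> set R) : uniq s ->
  (forall i, measurable (A i)) ->
  P (\big[setI/setT]_(i <- s) (X i @^-1` A i)) =
  (\prod_(i <- s) P (X 0 @^-1` A i))%E.
Proof.
move=> us mA; have [X_indep X_same] := X_iid.
rewrite -bigcap_seq X_indep//; apply: eq_bigr => i _; exact: X_same.
Qed.

Lemma iid_indep i j : i != j -> indep_rv P (X i) (X j).
Proof.
move=> ij A B mA mB; have [_ X_same] := X_iid.
have := @iid_box [:: i; j] (fun n => if n == i then A else B).
rewrite !big_cons !big_nil /= inE ij eqxx eq_sym (negbTE ij) setIT mule1 => -> //.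
  by rewrite (X_same i)// (X_same j).
by move=> n; case: ifP.
Qed.

Lemma iid_indep_pair i j k l : uniq [:: i; j; k; l] ->
  indep_rv P (rv_pair (X i) (X j)) (rv_pair (X k) (X l)).
Proof.
move=> u; have := u; rewrite /= !inE !negb_or => /and4P[/and3P[ij ik il] /andP[jk jl] kl _].
apply: indep_rv_pair => A1 A2 B1 B2 mA1 mA2 mB1 mB2; have [_ X_same] := X_iid.
pose A n := if n == i then A1 else if n == j then A2 else if n == k then B1 else B2.
have mA n : measurable (A n) by rewrite /A; do 3 case: ifP => // _.
have := iid_box u mA; rewrite !big_cons !big_nil /=.
rewrite /A !eqxx (eq_sym j i) (eq_sym k i) (eq_sym l i) (eq_sym k j) (eq_sym l j) (eq_sym l k).
rewrite (negbTE ij) (negbTE ik) (negbTE il) (negbTE jk) (negbTE jl) (negbTE kl).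
rewrite setIT mule1 -setIA => ->.
by rewrite (iid_indep ij)// (iid_indep kl)// !(X_same _ _) // muleA.
Qed.

(** All pairs of independent variables with the common marginal have the same
    joint law.  The pair [Y, Z] is left free so that it can be the independent
    copy in terms of which the limiting rate is defined. *)
Lemma iid_pair_integral i j (Y Z : {mfun T >-> R}) (k : R * R -> R) : i != j ->
  indep_rv P Y Z -> same_distribution P Y (X 0) -> same_distribution P Z (X 0) ->
  measurable_fun setT k -> (forall z, 0 <= k z) ->
  (\int[P]_w (k (X i w, X j w))%:E = \int[P]_w (k (Y w, Z w))%:E)%E.
Proof.
move=> ij YZ Y0 Z0 mk k0; have [_ X_same] := X_iid.
have kE (U V : {mfun T >-> R}) : (\int[P]_w (k (U w, V w))%:E =
    \int[distribution P (rv_pair U V)]_z (k z)%:E)%E.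
  by rewrite ge0_integral_distribution//; exact/measurable_EFinP.
rewrite !kE; apply: eq_measure_integral => C mC _.
apply: measure_unique_setX => //.
  by rewrite -[X in (X < _)%E]/(P (_ @^-1` setT)) preimage_setT probability_setT ltry.
move=> A B mA mB.
transitivity (P (X i @^-1` A `&` X j @^-1` B)) => //.
transitivity (P (Y @^-1` A `&` Z @^-1` B)) => //.
by rewrite (iid_indep ij)// YZ// Y0// Z0// (X_same i)// (X_same j).
Qed.

(** The pairs of index pairs whose kernels may be correlated. *)
Definition meets (p q : nat * nat) :=
  [|| p.1 == q.1, p.1 == q.2, p.2 == q.1 | p.2 == q.2].

(** Index pairs that do not meet give independent factors, and otherwise the
    product is at most [K ^ 2]. *)
Lemma iid_pair_mul i j k l (f : R * R -> R) (K kappa : R) :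
  i != j -> k != l -> measurable_fun setT f -> (forall z, 0 <= f z <= K) ->
  (\int[P]_w (f (X 0 w, X 1 w))%:E = kappa%:E)%E ->
  (\int[P]_w (f (X i w, X j w) * f (X k w, X l w))%:E <=
   (kappa ^+ 2 + if meets (i, j) (k, l) then K ^+ 2 else 0)%:E)%E.
Proof.
move=> ij kl mf fK fkappa; have f0 z : 0 <= f z by have /andP[] := fK z.
have K0 : 0 <= K by have /andP[+ +] := fK (0, 0); exact: le_trans.
have m_pair (a b : nat) : measurable_fun setT (fun w => f (X a w, X b w)).
  exact: (measurableT_comp mf (measurable_rv_pair (X a) (X b))).
have [_ X_same] := X_iid.
have fE (a b : nat) : a != b -> (\int[P]_w (f (X a w, X b w))%:E = kappa%:E)%E.
  by move=> ab; rewrite -fkappa; apply: iid_pair_integral => //; exact: iid_indep.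
case: ifPn => [_|].
  apply: (@le_trans _ _ (\int[P]_w (cst (K ^+ 2)%:E w))%E).
    apply: ge0_le_integral => //.
    - by move=> w _; rewrite lee_fin mulr_ge0.
    - by apply/measurable_EFinP/measurable_funM.
    - move=> w _; rewrite lee_fin expr2; apply: ler_pM => //.
        by have /andP[] := fK (X i w, X j w).
      by have /andP[] := fK (X k w, X l w).
  by rewrite integral_cst//= probability_setT mule1 lee_fin lerDr sqr_ge0.
rewrite /meets /= !negb_or => /and4P[ik il jk jl].
rewrite (indep_rv_mul (U := rv_pair (X i) (X j)) (V := rv_pair (X k) (X l)))//; last first.
  by apply: iid_indep_pair; rewrite /= !inE !negb_or ij ik il jk jl kl.
by rewrite !fE// addr0 expr2.
Qed.

End iid_weights.

(** * Expectations of nonnegative variables *)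

Section nonneg_expectation.
Context d (T : measurableType d) (R : realType) (P : probability T R).
Implicit Types f g : T -> R.

Local Notation rmeasurable f := (measurable_fun [set: T] (f : T -> R)).

Lemma measurable_sum_cond (I : Type) (s : seq I) (Q : pred I) (f : I -> T -> R) :
  (forall i, rmeasurable (f i)) -> rmeasurable (fun w => \sum_(i <- s | Q i) f i w).
Proof.
move=> mf; rewrite (_ : (fun w => _) = fun w => \sum_(i <- [seq i <- s | Q i]) f i w).
  exact: measurable_sum.
by apply/funext => w; rewrite big_filter.
Qed.

Lemma expect_add f g : rmeasurable f -> rmeasurable g ->
  (forall w, 0 <= f w) -> (forall w, 0 <= g w) ->
  (\int[P]_w (f w + g w)%:E = \int[P]_w (f w)%:E + \int[P]_w (g w)%:E)%E.
Proof.
move=> mf mg f0 g0; under eq_integral do rewrite EFinD.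
by apply: ge0_integralD => //; try (exact/measurable_EFinP); move=> w _; rewrite lee_fin.
Qed.

Lemma expect_scale (c : R) f : rmeasurable f -> 0 <= c -> (forall w, 0 <= f w) ->
  (\int[P]_w (c * f w)%:E = c%:E * \int[P]_w (f w)%:E)%E.
Proof.
move=> mf c0 f0; under eq_integral do rewrite EFinM.
by apply: ge0_integralZl_EFin => //; try (exact/measurable_EFinP); move=> w _; rewrite lee_fin.
Qed.

Lemma expect_sum (I : Type) (s : seq I) (Q : pred I) (f : I -> T -> R) :
  (forall i, rmeasurable (f i)) -> (forall i w, 0 <= f i w) ->
  (\int[P]_w (\sum_(i <- s | Q i) f i w)%:E =
   \sum_(i <- s | Q i) \int[P]_w (f i w)%:E)%E.
Proof.
move=> mf f0; under eq_integral do rewrite -sumEFin -big_filter.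
rewrite ge0_integral_sum ?big_filter// => i; first exact/measurable_EFinP.
by move=> w _; rewrite lee_fin.
Qed.

Lemma expect_cst (c : R) : (\int[P]_w c%:E = c%:E)%E.
Proof. by rewrite integral_cst//= probability_setT mule1. Qed.

Lemma expect_le f g : rmeasurable f -> rmeasurable g -> (forall w, 0 <= f w) ->
  (forall w, f w <= g w) -> (\int[P]_w (f w)%:E <= \int[P]_w (g w)%:E)%E.
Proof.
move=> mf mg f0 fg; apply: ge0_le_integral => //.
- by move=> w _; rewrite lee_fin.
- exact/measurable_EFinP.
- exact/measurable_EFinP.
- by move=> w _; rewrite lee_fin.
Qed.

End nonneg_expectation.

(** * Second moment of a U-statistic *)

Section U_statistics.
Context d (T : measurableType d) (R : realType) (P : probability T R).
Variable X : nat -> {mfun T >-> R}.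
Hypothesis X_iid : iid P (fun i => X i : T -> R).

Lemma measurable_kernel (f : R * R -> R) i j : measurable_fun setT f ->
  measurable_fun setT (fun w => f (X i w, X j w)).
Proof.
by move=> mf; exact: (measurableT_comp mf (measurable_rv_pair (X i) (X j))).
Qed.

Lemma card_pairs_le n (A B : {set 'I_n}) (S : pred ('I_n * 'I_n)) :
  (forall p, S p -> p.1 \in A /\ p.2 \in B) -> (#|S| <= #|A| * #|B|)%N.
Proof.
move=> SAB; rewrite -cardsX.
apply: subset_leq_card; apply/fintype.subsetP => -[p1 p2] /SAB[/= pA pB].
by rewrite inE /= pA pB.
Qed.

(** A pair that meets [p] has one of its two coordinates equal to [p.1] or to
    [p.2], and at most [M] choices for the other one. *)
Lemma card_meets n M (A B : {set 'I_n}) (S : pred ('I_n * 'I_n)) (p : 'I_n * 'I_n) :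
  (#|A| <= M)%N -> (#|B| <= M)%N -> (forall q, S q -> q.1 \in A /\ q.2 \in B) ->
  (#|[pred q | S q & meets (p.1 : nat, p.2 : nat) (q.1 : nat, q.2 : nat)]| <= 4 * M)%N.
Proof.
move=> AM BM SAB.
pose Z := (finset.setX [set p.1]%SET B :|: finset.setX A [set p.1]%SET :|:
  (finset.setX [set p.2]%SET B :|: finset.setX A [set p.2]%SET))%SET.
apply: (@leq_trans #|Z|).
  apply: subset_leq_card; apply/fintype.subsetP => -[q1 q2]; rewrite !inE /meets /=.
  move=> /andP[/SAB[/= -> ->]]; rewrite !andbT /=.
  rewrite (eq_sym q1 p.1) (eq_sym q2 p.1) (eq_sym q1 p.2) (eq_sym q2 p.2) -!val_eqE /=.
  by rewrite -orbA.
have cA x : (#|finset.setX A [set x]%SET| <= M)%N by rewrite cardsX cards1 muln1.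
have cB x : (#|finset.setX [set x]%SET B| <= M)%N by rewrite cardsX cards1 mul1n.
rewrite (_ : 4 * M = (M + M) + (M + M))%N; last by lia.
have cU (U V : {set 'I_n * 'I_n}) a b :
    (#|U| <= a)%N -> (#|V| <= b)%N -> (#|U :|: V|%SET <= a + b)%N.
  by move=> Ua Vb; apply: (leq_trans (leq_card_setU _ _)); exact: leq_add.
apply: (cU _ _); apply: (cU _ _); [exact: cB|exact: cA|exact: cB|exact: cA].
Qed.

(** Expanding the square, the uncorrelated part cancels against the square of
    the mean; what remains is at most [K ^ 2] for each of the [M ^ 2] pairs
    and each of the at most [4 M] pairs that meet it.  The set [S] of pairs is
    arbitrary in order to cover both the pairs between two blocks and the
    off-diagonal pairs inside a block. *)
Lemma U_second_moment (f : R * R -> R) (K kappa : R) n M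
    (A B : {set 'I_n}) (S : pred ('I_n * 'I_n)) :
  measurable_fun setT f -> (forall z, 0 <= f z <= K) ->
  (\int[P]_w (f (X 0 w, X 1 w))%:E = kappa%:E)%E ->
  (#|A| <= M)%N -> (#|B| <= M)%N ->
  (forall p, S p -> [/\ p.1 \in A, p.2 \in B & p.1 != p.2]) ->
  (\int[P]_w ((\sum_(p | S p) f (X p.1 w, X p.2 w) - #|S|%:R * kappa) ^+ 2)%:E
    <= (4 * M%:R ^+ 3 * K ^+ 2)%:E)%E.
Proof.
move=> mf fK fkappa AM BM SP.
have f0 z : 0 <= f z by have /andP[] := fK z.
have kappa0 : 0 <= kappa.
  by rewrite -lee_fin -fkappa; apply: integral_ge0 => w _; rewrite lee_fin.
have [_ X_same] := X_iid.
have mk i j := measurable_kernel i j mf.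
pose W w := \sum_(p : 'I_n * 'I_n | S p) f (X p.1 w, X p.2 w).
have mW : measurable_fun setT W.
  apply: (@measurable_sum_cond _ _ _ _ _ _
    (fun (p : 'I_n * 'I_n) w => f (X p.1 w, X p.2 w))) => p; exact: mk.
have W0 w : 0 <= W w by apply: sumr_ge0.
have EW : (\int[P]_w (W w)%:E = (#|S|%:R * kappa)%:E)%E.
  rewrite /W expect_sum//.
  rewrite (eq_bigr (fun=> kappa%:E)); last first.
    move=> p /SP[_ _ p12]; rewrite -fkappa.
    apply: (iid_pair_integral X_iid p12 (Y := X 0) (Z := X 1)) => //.
    exact: (iid_indep X_iid).
  by rewrite sumEFin sumr_const mulr_natl.
have cardS : (#|S| <= M * M)%N.
  apply: leq_trans (leq_mul AM BM); apply: card_pairs_le => p.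
  by case/SP.
have EW2 : (\int[P]_w (W w ^+ 2)%:E <=
    ((#|S|%:R * kappa) ^+ 2 + 4 * M%:R ^+ 3 * K ^+ 2)%:E)%E.
  under eq_integral do rewrite expr2 /W big_distrlr /=.
  rewrite expect_sum; last 2 first.
  - by move=> p; apply: measurable_sum_cond => q; exact: measurable_funM.
  - by move=> p w; apply: sumr_ge0 => q _; rewrite mulr_ge0.
  apply: (@le_trans _ _ (\sum_(p : 'I_n * 'I_n | S p)
      (#|S|%:R * kappa ^+ 2 + (4 * M)%:R * K ^+ 2)%:E)%E).
    apply: lee_sum => p Sp; rewrite expect_sum; last 2 first.
    - by move=> q; exact: measurable_funM.
    - by move=> q w; rewrite mulr_ge0.
    have [_ _ p12] := SP p Sp.
    apply: (@le_trans _ _ (\sum_(q : 'I_n * 'I_n | S q) (kappa ^+ 2 +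
        if meets (p.1 : nat, p.2 : nat) (q.1 : nat, q.2 : nat) then K ^+ 2 else 0)%:E)%E).
      apply: lee_sum => q Sq; have [_ _ q12] := SP q Sq.
      exact: (iid_pair_mul X_iid).
    rewrite sumEFin lee_fin big_split /= sumr_const mulr_natl lerD2l.
    rewrite -big_mkcondr sumr_const -[leLHS]mulr_natl ler_wpM2r ?sqr_ge0// ler_nat.
    by apply: (card_meets _ AM BM) => q /SP[].
  rewrite sumEFin lee_fin sumr_const -[leLHS]mulr_natl.
  have cardM : #|S|%:R * (4 * M)%:R <= 4 * M%:R ^+ 3 :> R.
    by rewrite -natrX -!natrM ler_nat (_ : 4 * M ^ 3 = M * M * (4 * M))%N ?leq_mul//; lia.
  rewrite [leLHS](_ : _ = (#|S|%:R * kappa) ^+ 2 + #|S|%:R * (4 * M)%:R * K ^+ 2); last by ring.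
  by rewrite lerD2l ler_wpM2r ?sqr_ge0.
have mWc : measurable_fun setT (fun w => (W w - #|S|%:R * kappa) ^+ 2).
  by apply: measurable_funX; apply: measurable_funB.
have c0 : 0 <= #|S|%:R * kappa by rewrite mulr_ge0.
set c := #|S|%:R * kappa in EW EW2 mWc c0 *.
(* [(W - c) ^ 2 + 2 c W = W ^ 2 + c ^ 2] keeps every integrand nonnegative. *)
have : (\int[P]_w ((W w - c) ^+ 2)%:E + (2 * c * c)%:E <=
    (4 * M%:R ^+ 3 * K ^+ 2)%:E + (2 * c * c)%:E)%E.
  rewrite [X in (_ + X <= _)%E](_ : _ = (\int[P]_w (2 * c * W w)%:E)%E); last first.
    by rewrite expect_scale// ?mulr_ge0// EW.
  rewrite -expect_add//; last 3 first.
  - exact: measurable_funM.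
  - by move=> w; rewrite sqr_ge0.
  - by move=> w; rewrite !mulr_ge0.
  under eq_integral => w _.
    rewrite (_ : (W w - c) ^+ 2 + 2 * c * W w = W w ^+ 2 + c ^+ 2); last by ring.
    over.
  rewrite expect_add; last 4 first.
  - exact: measurable_funX.
  - exact: measurable_cst.
  - by move=> w; exact: sqr_ge0.
  - by move=> w; exact: sqr_ge0.
  rewrite expect_cst; apply: (le_trans (leeD2r _ EW2)).
  rewrite -!EFinD lee_fin; lra.
by rewrite leeD2rE.
Qed.

End U_statistics.

(** * Convergence in mean of U-statistics *)

Section U_statistics_L1.
Context d (T : measurableType d) (R : realType) (P : probability T R).

(** Dominated convergence of [min Y n] to [Y]. *)
Lemma truncated_expectation (Y : T -> R) (kappa eta : R) :
  measurable_fun setT Y -> (forall w, 0 <= Y w) ->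
  (\int[P]_w (Y w)%:E = kappa%:E)%E -> 0 < eta ->
  exists K kappaK : R, [/\ 0 <= K, kappa - eta <= kappaK &
    (\int[P]_w (Num.min (Y w) K)%:E = kappaK%:E)%E].
Proof.
move=> mY Y0 EY eta0.
have intY : P.-integrable setT (EFin \o Y).
  apply/integrableP; split; first exact/measurable_EFinP.
  rewrite (eq_integral (fun w => (Y w)%:E)) ?EY ?ltry// => w _.
  by rewrite /= ger0_norm.
pose Yn n w := Num.min (Y w) n%:R.
have mYn n : measurable_fun setT (Yn n).
  by apply: measurable_minr => //; exact: measurable_cst.
have Yn0 n w : 0 <= Yn n w by rewrite le_min Y0 ler0n.
have YnY n w : Yn n w <= Y w by rewrite ge_min lexx.
have cvgYn w : setT w -> (EFin \o Yn n) w @[n --> \oo] --> (EFin \o Y) w.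
  move=> _; apply: cvg_near_cst; near=> n; rewrite /= /Yn min_l//.
  near: n; exact: nbhs_infty_ger.
have domYn w n : setT w -> (`|(EFin \o Yn n) w| <= (EFin \o Y) w)%E.
  by move=> _; rewrite /= lee_fin ger0_norm.
have mEYn n : measurable_fun setT (EFin \o Yn n) by exact/measurable_EFinP.
have mEY : measurable_fun setT (EFin \o Y) by exact/measurable_EFinP.
have [_ _] := dominated_convergence measurableT mEYn mEY
  (aeW P cvgYn) intY (aeW P domYn).
rewrite [X in _ --> X](_ : _ = kappa%:E) => [/fine_cvg cvgE|]; last by rewrite -EY.
have /cvgrPdist_le/(_ eta eta0)[N _ /(_ N (leqnn N))] := cvgE.
move=> /ler_normlP[_ Nle'].
have Nle : kappa - fine (\int[P]_w (Yn N w)%:E)%E <= eta := Nle'.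
exists N%:R, (fine (\int[P]_w (Yn N w)%:E)%E); split=> //; first lra.
rewrite fineK// ge0_fin_numE; last by apply: integral_ge0 => w _; rewrite lee_fin.
by apply: (le_lt_trans (expect_le P (mYn N) mY (Yn0 N) (YnY N))); rewrite EY ltry.
Unshelve. all: by end_near. Qed.

Variable X : nat -> {mfun T >-> R}.
Hypothesis X_iid : iid P (fun i => X i : T -> R).

(** Replaces the Cauchy-Schwarz inequality when passing from a second moment to
    a first one. *)
Lemma norm_le_sqr (delta t : R) : 0 < delta -> `|t| <= delta + delta^-1 * t ^+ 2.
Proof.
move=> delta0; have [tle|/ltW tgt] := leP `|t| delta.
  by rewrite (le_trans tle)// lerDl mulr_ge0 ?sqr_ge0// invr_ge0 ltW.
apply: (@le_trans _ _ (delta^-1 * t ^+ 2)); last by rewrite lerDr ltW.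
rewrite [leRHS]mulrC ler_pdivlMr// -(@real_normK _ t) ?num_real// expr2.
by rewrite ler_wpM2l.
Qed.

(** The three terms come from the mass lost by truncation, counted once in
    the sum and once in its mean, from the threshold [delta] of
    [norm_le_sqr], and from the second moment
    [M ^- 4 (4 M ^ 3 K ^ 2) / delta] of the truncated sum. *)
Lemma U_statistic_bound (f : R * R -> R) (K kappa kappaK delta : R) n M
    (A B : {set 'I_n}) (S : pred ('I_n * 'I_n)) :
  measurable_fun setT f -> (forall z, 0 <= f z) -> 0 <= K -> 0 < delta ->
  (\int[P]_w (f (X 0 w, X 1 w))%:E = kappa%:E)%E ->
  (\int[P]_w (Num.min (f (X 0 w, X 1 w)) K)%:E = kappaK%:E)%E ->
  (0 < M)%N -> (#|A| <= M)%N -> (#|B| <= M)%N ->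
  (forall p, S p -> [/\ p.1 \in A, p.2 \in B & p.1 != p.2]) ->
  (\int[P]_w (`|M%:R ^- 2 * \sum_(p | S p) f (X p.1 w, X p.2 w)
               - M%:R ^- 2 * #|S|%:R * kappa|)%:E
    <= (2 * (kappa - kappaK) + delta + 4 * K ^+ 2 / (delta * M%:R))%:E)%E.
Proof.
move=> mf f0 K0 delta0 Ef EfK M0 AM BM SP.
pose fK z := Num.min (f z) K.
have mfK : measurable_fun setT fK by apply: measurable_minr => //; exact: measurable_cst.
have fK0 z : 0 <= fK z by rewrite le_min f0.
have fKK z : 0 <= fK z <= K by rewrite fK0 ge_min lexx orbT.
have fKf z : 0 <= f z - fK z by rewrite subr_ge0 ge_min lexx.
have mB : measurable_fun setT (fun z => f z - fK z) by exact: measurable_funB.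
have mk g i j := @measurable_kernel _ _ _ X g i j.
have EB : (\int[P]_w (f (X 0 w, X 1 w) - fK (X 0 w, X 1 w))%:E = (kappa - kappaK)%:E)%E.
  have := expect_add P (mk _ 0%N 1%N mB) (mk _ 0%N 1%N mfK) (fun w => fKf _) (fun w => fK0 _).
  rewrite (eq_integral (fun w => (f (X 0 w, X 1 w))%:E)); last first.
    by move=> w _; rewrite subrK.
  rewrite Ef [X in (_ + X)%E]EfK.
  by case: (X in (X + _)%E) => [x||]//; rewrite -EFinD => -[->]; rewrite addrK.
have kappaB : 0 <= kappa - kappaK.
  by rewrite -lee_fin -EB; apply: integral_ge0 => w _; rewrite lee_fin.
have cardS : (#|S| <= M * M)%N.
  apply: leq_trans (leq_mul AM BM); apply: card_pairs_le => p.
  by case/SP.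
have M0' : 0 < M%:R :> R by rewrite ltr0n.
set a : R := M%:R ^- 2; have a0 : 0 <= a by rewrite invr_ge0 exprn_ge0.
have as1 : a * #|S|%:R <= 1.
  by rewrite mulrC ler_pdivrMr ?exprn_gt0// mul1r expr2 -natrM ler_nat.
pose V w := \sum_(p : 'I_n * 'I_n | S p) (f (X p.1 w, X p.2 w) - fK (X p.1 w, X p.2 w)).
pose WK w := \sum_(p : 'I_n * 'I_n | S p) fK (X p.1 w, X p.2 w).
have mV : measurable_fun setT V.
  apply: (@measurable_sum_cond _ _ _ _ _ _
    (fun (p : 'I_n * 'I_n) w => f (X p.1 w, X p.2 w) - fK (X p.1 w, X p.2 w))) => p.
  exact: (mk (fun z => f z - fK z)).
have mWK : measurable_fun setT WK.
  apply: (@measurable_sum_cond _ _ _ _ _ _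
    (fun (p : 'I_n * 'I_n) w => fK (X p.1 w, X p.2 w))) => p; exact: (mk fK).
have V0 w : 0 <= V w by apply: sumr_ge0.
have EV : (\int[P]_w (V w)%:E = (#|S|%:R * (kappa - kappaK))%:E)%E.
  rewrite /V expect_sum//; last by move=> p; exact: (mk (fun z => f z - fK z)).
  rewrite (eq_bigr (fun=> (kappa - kappaK)%:E)); last first.
    move=> p /SP[_ _ p12]; rewrite -EB.
    have [_ X_same] := X_iid.
    apply: (iid_pair_integral X_iid p12 (Y := X 0) (Z := X 1) (k := fun z => f z - fK z)) => //.
    exact: (iid_indep X_iid).
  by rewrite sumEFin sumr_const mulr_natl.
have EWK := U_second_moment X_iid mfK fKK EfK AM BM SP.
rewrite -/(WK _) in EWK.
pose c := delta + a * #|S|%:R * (kappa - kappaK).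
have c0 : 0 <= c by rewrite addr_ge0 ?(ltW delta0)// !mulr_ge0.
pose Q w := (WK w - #|S|%:R * kappaK) ^+ 2.
have mQ : measurable_fun setT Q by apply: measurable_funX; exact: measurable_funB.
have Q0 w : 0 <= Q w by exact: sqr_ge0.
have da0 : 0 <= delta^-1 * a ^+ 2 by rewrite mulr_ge0 ?exprn_ge0// invr_ge0 (ltW delta0).
have mbQ : measurable_fun setT (fun w => delta^-1 * a ^+ 2 * Q w).
  exact: measurable_funM.
have mcQ : measurable_fun setT (fun w => c + delta^-1 * a ^+ 2 * Q w).
  exact: measurable_funD.
have maV : measurable_fun setT (fun w => a * V w) by exact: measurable_funM.
have aV0 w : 0 <= a * V w by rewrite mulr_ge0.
have bQ0 w : 0 <= delta^-1 * a ^+ 2 * Q w by rewrite mulr_ge0.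
have cQ0 w : 0 <= c + delta^-1 * a ^+ 2 * Q w by rewrite addr_ge0.
apply: (@le_trans _ _ (\int[P]_w (a * V w + (c + delta^-1 * a ^+ 2 * Q w))%:E)%E).
  apply: expect_le => //.
  - apply: (measurableT_comp (@normr_measurable _ _)).
    apply: measurable_funB => //; apply: measurable_funM => //.
    apply: (@measurable_sum_cond _ _ _ _ _ _
      (fun (p : 'I_n * 'I_n) w => f (X p.1 w, X p.2 w))) => p; exact: mk.
  - exact: measurable_funD.
  move=> w.
  have -> : \sum_(p | S p) f (X p.1 w, X p.2 w) = V w + WK w.
    by rewrite -big_split /=; apply: eq_bigr => p _; rewrite subrK.
  have -> : a * (V w + WK w) - a * #|S|%:R * kappa =
      a * V w + (a * (WK w - #|S|%:R * kappaK) - a * #|S|%:R * (kappa - kappaK)) by ring.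
  apply: (le_trans (ler_normD _ _)); rewrite ger0_norm ?mulr_ge0// lerD2l.
  apply: (le_trans (ler_normB _ _)).
  rewrite [X in _ + X]ger0_norm ?mulr_ge0// /c [leRHS]addrAC lerD2r.
  by rewrite /Q -mulrA -exprMn; exact: norm_le_sqr.
rewrite expect_add// expect_add//.
rewrite expect_cst !expect_scale// EV -EFinM.
apply: (@le_trans _ _ ((a * (#|S|%:R * (kappa - kappaK)))%:E + (c%:E +
    (delta^-1 * a ^+ 2)%:E * (4 * M%:R ^+ 3 * K ^+ 2)%:E))%E).
  by rewrite leeD2l// leeD2l// lee_wpmul2l ?lee_fin.
rewrite -EFinM -!EFinD lee_fin /c.
have -> : delta^-1 * a ^+ 2 * (4 * M%:R ^+ 3 * K ^+ 2) = 4 * K ^+ 2 / (delta * M%:R).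
  by rewrite /a; field; rewrite !gt_eqF.
have : a * #|S|%:R * (kappa - kappaK) <= kappa - kappaK by rewrite ler_piMl.
rewrite mulrA; lra.
Qed.

(** The threshold [M0] depends neither on the index sets nor on the number of
    weights, whence the uniformity over blocks and over the size of the
    graph. *)
Lemma U_statistic_L1 (f : R * R -> R) (kappa eta : R) :
  measurable_fun setT f -> (forall z, 0 <= f z) ->
  (\int[P]_w (f (X 0 w, X 1 w))%:E = kappa%:E)%E -> 0 < eta ->
  exists M0 : nat, forall M n (A B : {set 'I_n}) (S : pred ('I_n * 'I_n)),
    (M0 <= M)%N -> (#|A| <= M)%N -> (#|B| <= M)%N ->
    (forall p, S p -> [/\ p.1 \in A, p.2 \in B & p.1 != p.2]) ->
    (\int[P]_w (`|M%:R ^- 2 * \sum_(p | S p) f (X p.1 w, X p.2 w)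
                 - M%:R ^- 2 * #|S|%:R * kappa|)%:E <= eta%:E)%E.
Proof.
move=> mf f0 Ef eta0.
have eta6 : 0 < eta / 6 by rewrite divr_gt0.
have eta3 : 0 < eta / 3 by rewrite divr_gt0.
have [K [kappaK [K0 kle EfK]]] := 
  truncated_expectation (measurable_kernel X 0 1 mf) (fun w => f0 _) Ef eta6.
(* With [delta = eta / 3], the third term is at most [eta / 3] as soon as
   [M >= 36 K ^ 2 / eta ^ 2]. *)
exists (Num.truncn (36 * K ^+ 2 / eta ^+ 2)).+1 => M n A B S M0 AM BM SP.
have M0' : (0 < M)%N by exact: leq_trans M0.
apply: (le_trans (U_statistic_bound mf f0 K0 eta3 Ef EfK M0' AM BM SP)).
rewrite lee_fin.
have : 36 * K ^+ 2 / eta ^+ 2 <= M%:R.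
  by rewrite (le_trans (ltW (truncnS_gt _)))// ler_nat.
rewrite ler_pdivrMr ?exprn_gt0// => KM.
have : 4 * K ^+ 2 / (eta / 3 * M%:R) <= eta / 3.
  rewrite ler_pdivrMr ?mulr_gt0 ?ltr0n//.
  nra.
lra.
Qed.

End U_statistics_L1.

(** * Exchangeability of i.i.d. weights *)

Section exchangeability.
Context d (T : measurableType d) (R : realType) (P : probability T R).
Variable X : nat -> {mfun T >-> R}.
Hypothesis X_iid : iid P (fun i => X i : T -> R).
Variable M : nat.

Definition rv_tuple (t : M.-tuple nat) : T -> M.-tuple R :=
  fun w => [tuple X (tnth t i) w | i < M].

Lemma measurable_rv_tuple t : measurable_fun setT (rv_tuple t).
Proof.
apply/measurable_fun_tnthP => i.
rewrite (_ : _ \o _ = X (tnth t i)); first exact: measurable_funP.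
by apply/funext => w; rewrite /= tnth_mktuple.
Qed.

HB.instance Definition _ t :=
  isMeasurableFun.Build _ _ _ _ (rv_tuple t) (measurable_rv_tuple t).

(** Boxes are indexed by sequences of sets on all of [nat], of which only the
    first [M] count; this makes them a pi-system without any change of index
    type. *)
Definition box (B : nat -> set R) : set (M.-tuple R) :=
  \big[setI/setT]_(i < M) ((fun x => tnth x i) @^-1` B i).

Lemma measurable_tuple_boxE : @measurable _ (M.-tuple R) =
  <<s [set box B | B in [set B : nat -> set R | forall i, measurable (B i)]] >>.
Proof.
rewrite eqEsubset; split.
- apply: smallest_sub; first exact: smallest_sigma_algebra.
  move=> C; rewrite -bigcup_seq => -[i /= _ [A mA <-]].
  apply: sub_sigma_algebra; exists (fun j : nat => if j == i :> nat then A else setT).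
    by move=> j /=; case: ifP.
  rewrite /box (bigD1 i)//= eqxx big1 ?setIT ?setTI// => j ji.
  by rewrite -val_eqE in ji; rewrite (negbTE ji) preimage_setT.
- apply: smallest_sub; first exact: sigma_algebra_measurable.
  move=> _ [B mB <-]; rewrite /box; apply: bigsetI_measurable => i _.
  by rewrite -[X in measurable X]setTI; exact: measurable_tnth.
Qed.

Lemma rv_tuple_box (t : M.-tuple nat) (B : nat -> set R) : uniq t -> (forall i, measurable (B i)) ->
  P (rv_tuple t @^-1` box B) = (\prod_(i < M) P (X 0 @^-1` B i))%E.
Proof.
move=> ut mB.
have := iid_box X_iid (A := fun n => B (index n t)) ut (fun n => mB _).
rewrite !big_tuple.
have idx (i : 'I_M) : index (tnth t i) t = i.
  by rewrite (tnth_nth 0%N) index_uniq// size_tuple.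
under [in RHS]eq_bigr do rewrite idx.
move=> <-; congr (P _); rewrite /box.
rewrite (big_morph _ (preimage_setI _) (preimage_setT _)).
apply: eq_bigr => i _; rewrite idx.
by apply/seteqP; split => w /=; rewrite tnth_mktuple.
Qed.

Lemma rv_tuple_law (t u : M.-tuple nat) : uniq t -> uniq u -> forall C, measurable C ->
  P (rv_tuple t @^-1` C) = P (rv_tuple u @^-1` C).
Proof.
move=> ut uu; apply: (measure_unique
  [set box B | B in [set B : nat -> set R | forall i, measurable (B i)]] (fun=> setT)
  _ _ _ _ (distribution P (rv_tuple t)) (distribution P (rv_tuple u))).
- exact: measurable_tuple_boxE.
- move=> _ _ [A mA <-] [B mB <-]; exists (fun i => A i `&` B i).
    by move=> i /=; apply: measurableI.
  by rewrite /box -big_split /=.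
- move=> _; exists (fun=> setT) => //.
  by rewrite /box big1// => i _; rewrite preimage_setT.
- by rewrite bigcup_const.
- move=> _ [B mB <-].
  transitivity (P (rv_tuple t @^-1` box B)) => //.
  transitivity (P (rv_tuple u @^-1` box B)) => //.
  by rewrite !rv_tuple_box.
- by move=> _; rewrite -[X in (X < _)%E]/(P (_ @^-1` setT)) preimage_setT probability_setT ltry.
Qed.

(** The vectors of weights along [s] and along [0, ..., M - 1] have the same
    law, since their laws agree on boxes. *)
Lemma exchangeable_sum (f : R -> R) (s : seq nat) (B : set R) :
  measurable_fun setT f -> uniq s -> size s = M -> measurable B ->
  P ((fun w => \sum_(i <- s) f (X i w)) @^-1` B) =
  P ((fun w => \sum_(i < M) f (X i w)) @^-1` B).
Proof.
move=> mf us sM mB.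
pose F (x : M.-tuple R) := \sum_(i < M) f (tnth x i).
have mF : measurable_fun setT F.
  apply: measurable_sum => i; apply: (measurableT_comp mf); exact: measurable_tnth.
have mC : measurable (F @^-1` B) by rewrite -[X in measurable X]setTI; exact: mF.
have sumE (t : M.-tuple nat) : (fun w => \sum_(i <- t) f (X i w)) @^-1` B =
    rv_tuple t @^-1` (F @^-1` B).
  suff -> : (fun w => \sum_(i <- t) f (X i w)) = F \o rv_tuple t by [].
  apply/funext => w /=; rewrite big_tuple; apply: eq_bigr => i _.
  by rewrite tnth_mktuple.
have iota_size : size (iota 0 M) == M by rewrite size_iota.
rewrite [in RHS](_ : (fun w => _) = fun w => \sum_(i <- Tuple iota_size) f (X i w)); last first.
  by apply/funext => w; rewrite -(big_mkord xpredT (fun i => f (X i w))) /index_iota subn0.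
have sM' : size s == M by apply/eqP.
rewrite (sumE (Tuple sM')) (sumE (Tuple iota_size)).
apply: rv_tuple_law => //; exact: iota_uniq.
Qed.

End exchangeability.

(** * From edge probabilities to expected relative entropy *)

Section expected_entropy.
Context d (T : measurableType d) (R : realType) (P : probability T R).

Lemma sum_pairs_lt N (c : R) :
  \sum_(i < N) \sum_(j < N | (i < j)%N) c = 'C(N, 2)%:R * c.
Proof.
rewrite (exchange_big_dep xpredT)//= -bin2_sum big_mkord natr_sum mulr_suml.
apply: eq_bigr => j _.
by rewrite (big_ord_narrow (ltnW (ltn_ord j))) sumr_const card_ord mulr_natl.
Qed.

Lemma measurable_h (v : R) : measurable_fun [set: R] (fun u => h u v).
Proof.
rewrite /h; apply: measurable_funD; apply: measurable_funM => //.
- apply: (measurableT_comp (@measurable_ln R)); exact: measurable_funM.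
- exact: measurable_funB.
- apply: (measurableT_comp (@measurable_ln R)); apply: measurable_funM => //.
  exact: measurable_funB.
Qed.

(** [Delta] is an average of entropies over the edges plus an average over the
    loops, and each entropy is at most a constant times the distance of its
    parameters, so the number of vertices drops out of the bound. *)
Lemma expect_Delta_le N (mu : T -> graph_law R N) (p_ne p_eq eta : R) :
  0 < p_ne < 1 -> 0 < p_eq < 1 -> 0 <= eta ->
  (forall a b, measurable_fun setT (fun w => edge_prob (mu w) a b)) ->
  (forall a b w, 0 <= edge_prob (mu w) a b <= 1) ->
  (forall a b, a != b ->
     (\int[P]_w (`|edge_prob (mu w) a b - p_ne|)%:E <= eta%:E)%E) ->
  (forall a, (\int[P]_w (`|edge_prob (mu w) a a - p_eq|)%:E <= eta%:E)%E) ->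
  (0 <= 'E_P[fun w => Delta (mu w) (er_law N p_ne p_eq)] <=
   (((p_ne * (1 - p_ne))^-1 + (p_eq * (1 - p_eq))^-1) * eta)%:E)%E.
Proof.
move=> pne01 peq01 eta0 mmu mu01 mu_ne mu_eq.
have /andP[pne0 pne1] := pne01; have /andP[peq0 peq1] := peq01.
set c := (p_ne * (1 - p_ne))^-1; set c' := (p_eq * (1 - p_eq))^-1.
have c0 : 0 <= c by rewrite invr_ge0 mulr_ge0 ?subr_ge0 ?ltW.
have c'0 : 0 <= c' by rewrite invr_ge0 mulr_ge0 ?subr_ge0 ?ltW.
pose hne a b w := h (edge_prob (mu w) a b) p_ne.
pose heq a w := h (edge_prob (mu w) a a) p_eq.
have hne0 a b w : 0 <= hne a b w by exact: h_ge0.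
have heq0 a w : 0 <= heq a w by exact: h_ge0.
have mhne a b : measurable_fun setT (hne a b).
  exact: (measurableT_comp (measurable_h _) (mmu a b)).
have mheq a : measurable_fun setT (heq a).
  exact: (measurableT_comp (measurable_h _) (mmu a a)).
have mdist a b p : measurable_fun setT (fun w => `|edge_prob (mu w) a b - p|).
  by apply: (measurableT_comp (@normr_measurable _ _)); exact: measurable_funB.
have Ehne a b : a != b -> (\int[P]_w (hne a b w)%:E <= (c * eta)%:E)%E.
  move=> ab; apply: (@le_trans _ _ (\int[P]_w (c * `|edge_prob (mu w) a b - p_ne|)%:E)%E).
    apply: expect_le => //; first exact: measurable_funM.
    by move=> w; exact: h_le_dist.
  by rewrite expect_scale// EFinM lee_wpmul2l ?lee_fin// mu_ne.
have Eheq a : (\int[P]_w (heq a w)%:E <= (c' * eta)%:E)%E.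
  apply: (@le_trans _ _ (\int[P]_w (c' * `|edge_prob (mu w) a a - p_eq|)%:E)%E).
    apply: expect_le => //; first exact: measurable_funM.
    by move=> w; exact: h_le_dist.
  by rewrite expect_scale// EFinM lee_wpmul2l ?lee_fin// mu_eq.
pose Sne w := \sum_(a < N) \sum_(b < N | (a < b)%N) hne a b w.
pose Seq w := \sum_(a < N) heq a w.
have DeltaE w : Delta (mu w) (er_law N p_ne p_eq) =
    'C(N, 2)%:R^-1 * Sne w + N%:R^-1 * Seq w.
  rewrite /Delta /S_ne /S_eq; congr (_ * _ + _ * _).
    apply: eq_bigr => a _; apply: eq_bigr => b ab.
    by rewrite edge_prob_er -val_eqE ltn_eqF.
  by apply: eq_bigr => a _; rewrite edge_prob_er eqxx.
have mSne_ (a : 'I_N) : measurable_fun setT (fun w => \sum_(b < N | (a < b)%N) hne a b w).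
  exact: (@measurable_sum_cond _ _ _ _ _ _ (fun b w => hne a b w)).
have mSne : measurable_fun setT Sne.
  exact: (@measurable_sum_cond _ _ _ _ _ _ 
    (fun (a : 'I_N) w => \sum_(b < N | (a < b)%N) hne a b w) mSne_).
have mSeq : measurable_fun setT Seq.
  exact: (@measurable_sum_cond _ _ _ _ _ _ (fun a w => heq a w)).
have Sne_0 (a : 'I_N) w : 0 <= \sum_(b < N | (a < b)%N) hne a b w by apply: sumr_ge0.
have Sne0 w : 0 <= Sne w by apply: sumr_ge0.
have Seq0 w : 0 <= Seq w by apply: sumr_ge0.
have ESne : (\int[P]_w (Sne w)%:E <= ('C(N, 2)%:R * (c * eta))%:E)%E.
  rewrite -sum_pairs_lt /Sne expect_sum// -sumEFin; apply: lee_sum => a _.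
  rewrite expect_sum// -sumEFin; apply: lee_sum => b ab.
  by apply: Ehne; rewrite -val_eqE /= ltn_eqF.
have ESeq : (\int[P]_w (Seq w)%:E <= (N%:R * (c' * eta))%:E)%E.
  rewrite /Seq expect_sum//; apply: (@le_trans _ _ (\sum_(a < N) (c' * eta)%:E)%E).
    by apply: lee_sum => a _.
  by rewrite sumEFin sumr_const card_ord mulr_natl.
have avg (k : nat) (x : R) : 0 <= x -> k%:R^-1 * (k%:R * x) <= x.
  move=> x0; case: k => [|k]; first by rewrite mul0r mulr0.
  by rewrite mulKf// pnatr_eq0.
apply/andP; split.
  apply: expectation_ge0 => w; rewrite DeltaE.
  by rewrite addr_ge0// mulr_ge0// invr_ge0.
rewrite unlock (eq_integral (fun w => ('C(N, 2)%:R^-1 * Sne w + N%:R^-1 * Seq w)%:E)); last first.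
  by move=> w _; rewrite DeltaE.
rewrite expect_add; last 4 first.
- exact: measurable_funM.
- exact: measurable_funM.
- by move=> w; rewrite mulr_ge0// invr_ge0.
- by move=> w; rewrite mulr_ge0// invr_ge0.
rewrite mulrDl EFinD; apply: leeD.
  rewrite expect_scale ?invr_ge0//.
  apply: (@le_trans _ _ ('C(N, 2)%:R^-1%:E * ('C(N, 2)%:R * (c * eta))%:E)%E).
    by apply: lee_wpmul2l => //; rewrite lee_fin invr_ge0.
  by rewrite -EFinM lee_fin avg// mulr_ge0.
rewrite expect_scale ?invr_ge0//.
apply: (@le_trans _ _ (N%:R^-1%:E * (N%:R * (c' * eta))%:E)%E).
  by apply: lee_wpmul2l => //; rewrite lee_fin invr_ge0.
by rewrite -EFinM lee_fin avg// mulr_ge0.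
Qed.

End expected_entropy.

(** * Concentration of the block rates *)

Section block_probabilities.
Context d (T : measurableType d) (R : realType) (P : probability T R).
Variable X : nat -> {mfun T >-> R}.
Hypothesis X_iid : iid P (fun i => X i : T -> R).
Variables (f : R * R -> R) (q : R).
Hypotheses (mf : measurable_fun setT f) (f0 : forall z, 0 <= f z).
Hypothesis Ef : (\int[P]_w (f (X 0 w, X 1 w))%:E = q%:E)%E.

Lemma measurable_kernel_sum n (A B : {set 'I_n}) :
  measurable_fun setT (fun w => \sum_(i in A) \sum_(j in B) f (X i w, X j w)).
Proof.
apply: (@measurable_sum_cond _ _ _ _ _ _
  (fun (i : 'I_n) w => \sum_(j in B) f (X i w, X j w))) => i.
apply: (@measurable_sum_cond _ _ _ _ _ _
  (fun (j : 'I_n) w => f (X i w, X j w))) => j.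
exact: (@measurable_kernel _ _ _ X f i j mf).
Qed.

Lemma measurable_weight_sum (e : R -> R) n (A : {set 'I_n}) : measurable_fun setT e ->
  measurable_fun setT (fun w => \sum_(i in A) e (X i w)).
Proof.
move=> me; apply: (@measurable_sum_cond _ _ _ _ _ _ (fun (i : 'I_n) w => e (X i w))) => i.
exact: measurableT_comp.
Qed.

Lemma expect_q_ge0 : 0 <= q.
Proof. by rewrite -lee_fin -Ef; apply: integral_ge0 => w _; rewrite lee_fin. Qed.

(** Between disjoint blocks there are exactly [M ^ 2] pairs, all off-diagonal,
    so the mean of the rate is exactly [q]. *)
Lemma edge_prob_L1 (eta : R) : 0 < eta ->
  exists M0 : nat, forall M n (A B : {set 'I_n}), (M0 <= M)%N ->
    #|A| = M -> #|B| = M -> (forall i, i \in A -> i \in B -> False) ->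
    (\int[P]_w (`|expR (- (M%:R ^- 2 * \sum_(i in A) \sum_(j in B) f (X i w, X j w)))
                  - expR (- q)|)%:E <= eta%:E)%E.
Proof.
move=> eta0; have [M0 H] := U_statistic_L1 X_iid mf f0 Ef eta0.
(* The successor excludes [M = 0]. *)
exists M0.+1 => M n A B M0M cA cB AB.
pose S := [pred p : 'I_n * 'I_n | (p.1 \in A) && (p.2 \in B)].
have cS : #|S| = (M * M)%N.
  rewrite -{1}cA -cB -cardsX; apply: eq_card => -[i j].
  by rewrite !inE.
have Mn0 : M%:R != 0 :> R by rewrite pnatr_eq0 -lt0n; exact: leq_trans M0M.
have SP p : S p -> [/\ p.1 \in A, p.2 \in B & p.1 != p.2].
  move=> /andP[pA pB]; split=> //; apply/eqP => p12.
  by apply: (AB p.1) => //; rewrite p12.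
have cA' : (#|A| <= M)%N by rewrite cA.
have cB' : (#|B| <= M)%N by rewrite cB.
apply: le_trans (H M n A B S (ltnW M0M) cA' cB' SP).
pose W w := \sum_(i in A) \sum_(j in B) f (X i w, X j w).
have WE w : \sum_(p | S p) f (X p.1 w, X p.2 w) = W w by rewrite /W pair_big.
have -> : M%:R ^- 2 * #|S|%:R * q = q by rewrite cS natrM -expr2 mulVf ?mul1r// expf_neq0.
under [leRHS]eq_integral do rewrite WE.
have mW : measurable_fun setT W by exact: measurable_kernel_sum.
have maW : measurable_fun setT (fun w => M%:R ^- 2 * W w) by exact: measurable_funM.
apply: expect_le => //.
- apply: (measurableT_comp (@normr_measurable _ _)); apply: measurable_funB => //.
  apply: (measurableT_comp (@measurable_expR R)).
  exact: (measurableT_comp (@oppr_measurable R _)).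
- by apply: (measurableT_comp (@normr_measurable _ _)); exact: measurable_funB.
- move=> w; apply: dist_expRN_le; last exact: expect_q_ge0.
  by rewrite mulr_ge0 ?invr_ge0 ?exprn_ge0//; do 2!apply: sumr_ge0 => ? _.
Qed.

Variables (e : R -> R) (q' : R).
Hypotheses (me : measurable_fun setT e) (e0 : forall x, 0 <= e x).
Hypothesis Ee : (\int[P]_w (e (X 0 w))%:E = q'%:E)%E.
Hypothesis diag_cvg : cvg_in_probability P
  (fun k w => k%:R ^- 2 * \sum_(i < k) f (X i w, X i w)) (fun _ => 0).

Lemma measurable_diag : measurable_fun setT (fun x => f (x, x)).
Proof.
apply: (measurableT_comp mf); apply/measurable_fun_pairP.
by split; exact: measurable_id.
Qed.

Lemma measurable_diag_event eps M n (A : {set 'I_n}) :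
  measurable [set w | eps <= M%:R ^- 2 * \sum_(i in A) f (X i w, X i w)].
Proof.
pose D w := M%:R ^- 2 * \sum_(i in A) f (X i w, X i w).
have mD : measurable_fun setT D.
  apply: measurable_funM => //.
  exact: (measurable_weight_sum A measurable_diag).
rewrite (_ : [set w | _] = D @^-1` `[eps, +oo[%classic).
  by rewrite -[X in measurable X]setTI; exact: mD.
by apply/seteqP; split => w /=; rewrite in_itv/= andbT.
Qed.

(** By exchangeability the diagonal of any set of [M] indices has the law of
    that of the first [M] ones. *)
Lemma diag_tail (eps eta : R) : 0 < eps -> 0 < eta ->
  exists M0 : nat, forall M n (A : {set 'I_n}), (M0 <= M)%N -> #|A| = M ->
    (P [set w | eps <= M%:R ^- 2 * \sum_(i in A) f (X i w, X i w)]%R <= eta%:E)%E.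
Proof.
move=> eps0 eta0.
have /fine_cvgP[_ /cvgrPdist_le/(_ eta eta0)[M0 _ H]] := diag_cvg eps0.
exists M0 => M n A M0M cA; have := H M M0M.
rewrite /= sub0r normrN.
pose B : set R := [set y | eps <= M%:R ^- 2 * y].
have mB : measurable B.
  rewrite (_ : B = (fun y => M%:R ^- 2 * y) @^-1` `[eps, +oo[%classic).
    by rewrite -[X in measurable X]setTI; apply: measurable_funM => //.
  by apply/seteqP; split => y /=; rewrite in_itv/= andbT.
have -> : [set w | eps <= `|M%:R ^- 2 * \sum_(i < M) f (X i w, X i w) - 0|] =
    (fun w => \sum_(i < M) f (X i w, X i w)) @^-1` B.
  apply/seteqP; split => w /=; rewrite subr0 ger0_norm//;
  by rewrite mulr_ge0 ?invr_ge0 ?exprn_ge0//; apply: sumr_ge0.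
pose s := [seq val i | i <- enum A].
have us : uniq s by rewrite map_inj_uniq ?enum_uniq//; exact: val_inj.
have sM : size s = M by rewrite size_map -cardE.
have := exchangeable_sum X_iid measurable_diag us sM mB.
have -> : (fun w => \sum_(i <- s) f (X i w, X i w)) @^-1` B =
    [set w | eps <= M%:R ^- 2 * \sum_(i in A) f (X i w, X i w)].
  by apply/seteqP; split => w /=; rewrite /B /= big_map big_enum.
move=> <- PE; rewrite -[leLHS]fineK ?lee_fin.
  by apply: le_trans PE; exact: ler_norm.
apply: fin_num_measure; exact: measurable_diag_event.
Qed.

(** If the diagonal part [D] is below [eps] the Lipschitz bound is used, and
    otherwise the trivial bound 1; the mean of the indicator is the
    probability that [D] is at least [eps]. *)
Lemma loop_exponent_dist (t a D G kappa eps S : R) :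
  0 <= D -> 0 <= G -> 0 < eps -> 0 <= kappa -> 0 <= a ->
  0 <= S -> 2 * S = t + kappa - a * kappa + D + G ->
  `|expR (- S) - expR (- (2^-1 * kappa))| <=
  `|t| + ((a * kappa + eps) + (G + (eps <= D)%R%:R)).
Proof.
move=> D0 G0 eps0 kappa0 a0 S0 SE.
have ak0 : 0 <= a * kappa by exact: mulr_ge0.
have k20 : 0 <= 2^-1 * kappa by rewrite mulr_ge0.
have := normr_ge0 t; have := ler_norm t; have := ler_norm (- t); rewrite normrN => t1 t2 t3.
case: (leP eps D) => eD /=.
  by apply: (le_trans (dist_expRN_le1 S0 k20)); rewrite mulr1n; lra.
apply: (le_trans (dist_expRN_le S0 k20)); rewrite mulr0n addr0.
by rewrite ler_norml; apply/andP; split; lra.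
Qed.

(** With the kernel [k z = f z + e z.1], twice the loop rate is the
    U-statistic of [k] over off-diagonal pairs plus two remainders: the
    diagonal [D] of [f], and [M ^- 2] times the sum of [e], because the
    off-diagonal sum counts each [e (X i)] only [M - 1] times.  The term
    [M^-1 * kappa] accounts for the [M] missing diagonal pairs in the mean. *)
Lemma loop_prob_L1 (eta : R) : 0 < eta ->
  exists M0 : nat, forall M n (A : {set 'I_n}), (M0 <= M)%N -> #|A| = M ->
    (\int[P]_w (`|expR (- (2^-1 * (M%:R ^- 2 * \sum_(i in A) \sum_(j in A) f (X i w, X j w)
                            + M%:R^-1 * \sum_(i in A) e (X i w))))
                  - expR (- (2^-1 * (q + q')))|)%:E <= eta%:E)%E.
Proof.
move=> eta0.
have eta4 : 0 < eta / 4 by rewrite divr_gt0.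
have q0 := expect_q_ge0.
have q'0 : 0 <= q' by rewrite -lee_fin -Ee; apply: integral_ge0 => w _; rewrite lee_fin.
pose k (z : R * R) := f z + e z.1.
have me1 : measurable_fun setT (fun z : R * R => e z.1) by exact: measurableT_comp.
have mk : measurable_fun setT k by exact: measurable_funD.
have k0 z : 0 <= k z by rewrite addr_ge0.
have meX i : measurable_fun setT (fun w => e (X i w)) by exact: measurableT_comp.
have Ek : (\int[P]_w (k (X 0 w, X 1 w))%:E = (q + q')%:E)%E.
  by rewrite /k expect_add//; [rewrite Ef Ee
    |exact: (@measurable_kernel _ _ _ X f 0 1 mf)|exact: meX].
have [M1 H1] := U_statistic_L1 X_iid mk k0 Ek eta4.
have [M2 H2] := diag_tail eta4 eta4.
exists (maxn M1 (maxn M2 (Num.truncn (4 * (q + q' + q') / eta)).+1)) => M n A.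
rewrite !geq_max => /and3P[M1M M2M M3M] cA.
have M0 : (0 < M)%N by exact: leq_trans M3M.
have M0' : 0 < M%:R :> R by rewrite ltr0n.
have Mn0 : M%:R != 0 :> R by rewrite gt_eqF.
have Mlarge : M%:R^-1 * (q + q') + M%:R^-1 * q' <= eta / 4.
  rewrite -mulrDr mulrC ler_pdivrMr//.
  have : 4 * (q + q' + q') / eta <= M%:R.
    by rewrite (le_trans (ltW (truncnS_gt _)))// ler_nat.
  by rewrite ler_pdivrMr//; lra.
set kappa := q + q' in Ek H1 Mlarge *.
have kappa0 : 0 <= kappa by rewrite addr_ge0.
pose S := [pred p : 'I_n * 'I_n | [&& p.1 \in A, p.2 \in A & p.1 != p.2]].
have SP p : S p -> [/\ p.1 \in A, p.2 \in A & p.1 != p.2] by move=> /and3P.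
have sumS (F : 'I_n -> 'I_n -> R) : \sum_(i in A) \sum_(j in A) F i j =
    \sum_(p | S p) F p.1 p.2 + \sum_(i in A) F i i.
  rewrite pair_big /= (bigID (fun p : 'I_n * 'I_n => p.1 != p.2)) /=; congr (_ + _).
    by apply: eq_bigl => p; rewrite andbA.
  rewrite (reindex_omap (fun i : 'I_n => (i, i)) (fun p : 'I_n * 'I_n => Some p.1)) /=.
    by apply: eq_bigl => i; rewrite !eqxx !andbT andbb.
  by move=> [i j] /= /andP[_]; rewrite negbK => /eqP ->.
have cA' : (#|A| <= M)%N by rewrite cA.
have H1A := H1 M n A A S M1M cA' cA' SP.
have H2A := H2 M n A M2M cA.
have cS : #|S|%:R = M%:R ^+ 2 - M%:R :> R.
  have := sumS (fun _ _ => 1); rewrite !sumr_const cA -[M%:R *+ M]mulr_natl.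
  have -> : #|[pred i | S i]| = #|S| by apply: eq_card.
  by rewrite expr2 => ->; rewrite addrK.
pose t w := M%:R ^- 2 * \sum_(p | S p) k (X p.1 w, X p.2 w)
   - M%:R ^- 2 * #|S|%:R * kappa.
pose D w := M%:R ^- 2 * \sum_(i in A) f (X i w, X i w).
pose G w := M%:R ^- 2 * \sum_(i in A) e (X i w).
pose Z w := 2^-1 * (M%:R ^- 2 * \sum_(i in A) \sum_(j in A) f (X i w, X j w)
                    + M%:R^-1 * \sum_(i in A) e (X i w)).
have D0 w : 0 <= D w by rewrite mulr_ge0 ?invr_ge0 ?exprn_ge0//; apply: sumr_ge0.
have G0 w : 0 <= G w by rewrite mulr_ge0 ?invr_ge0 ?exprn_ge0//; apply: sumr_ge0.
have Z0 w : 0 <= Z w.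
  rewrite mulr_ge0// addr_ge0// mulr_ge0 ?invr_ge0 ?exprn_ge0//; apply: sumr_ge0 => // i _.
  exact: sumr_ge0.
have ZE w : 2 * Z w = t w + kappa - M%:R^-1 * kappa + D w + G w.
  rewrite /Z /t /D /G cS sumS.
  have -> : \sum_(p | S p) k (X p.1 w, X p.2 w) =
      \sum_(p | S p) f (X p.1 w, X p.2 w) +
      (M%:R * \sum_(i in A) e (X i w) - \sum_(i in A) e (X i w)).
    rewrite big_split /=; congr (_ + _); apply/eqP; rewrite eq_sym subr_eq; apply/eqP.
    rewrite -(sumS (fun i _ => e (X i w))) mulr_sumr; apply: eq_bigr => i _.
    by rewrite sumr_const cA mulr_natl.
  by field.
pose E := [set w | eta / 4 <= D w].
have mE : measurable E by exact: measurable_diag_event.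
have EE w : (eta / 4 <= D w)%R%:R = \1_E w :> R.
  by rewrite indicE (_ : (w \in E) = (eta / 4 <= D w)%R)//; apply/idP/idP; rewrite inE.
have mt : measurable_fun setT t.
  apply: measurable_funB => //; apply: measurable_funM => //.
  apply: (@measurable_sum_cond _ _ _ _ _ _
    (fun (p : 'I_n * 'I_n) w => k (X p.1 w, X p.2 w))) => p.
  exact: (@measurable_kernel _ _ _ X k).
have mnt : measurable_fun setT (fun w => `|t w|).
  exact: (measurableT_comp (@normr_measurable _ _)).
have mG : measurable_fun setT G.
  by apply: measurable_funM => //; exact: measurable_weight_sum.
have m1E : measurable_fun setT (\1_E : T -> R) by exact: measurable_indic.
have mZ : measurable_fun setT Z.
  apply: measurable_funM => //; apply: measurable_funD; apply: measurable_funM => //.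
    exact: measurable_kernel_sum.
  exact: measurable_weight_sum.
pose c := M%:R^-1 * kappa + eta / 4.
have c0 : 0 <= c by rewrite addr_ge0 ?(ltW eta4)// mulr_ge0// invr_ge0 ltW.
have i0 w : 0 <= \1_E w :> R by rewrite indicE.
have mGE : measurable_fun setT (fun w => G w + \1_E w) by exact: measurable_funD.
have mcGE : measurable_fun setT (fun w => c + (G w + \1_E w)) by exact: measurable_funD.
have GE0 w : 0 <= G w + \1_E w by rewrite addr_ge0.
have cGE0 w : 0 <= c + (G w + \1_E w) by rewrite addr_ge0.
apply: (@le_trans _ _ (\int[P]_w (`|t w| + (c + (G w + \1_E w)))%:E)%E).
  apply: expect_le => //.
  - apply: (measurableT_comp (@normr_measurable _ _)); apply: measurable_funB => //.
    apply: (measurableT_comp (@measurable_expR R)).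
    exact: (measurableT_comp (@oppr_measurable R _)).
  - exact: measurable_funD.
  - move=> w; rewrite -EE; apply: (loop_exponent_dist (D0 w) (G0 w) eta4 kappa0 _ (Z0 w) (ZE w)).
    by rewrite invr_ge0 ltW.
rewrite expect_add// expect_add// expect_cst expect_add//.
have EG : (\int[P]_w (G w)%:E = (M%:R^-1 * q')%:E)%E.
  rewrite /G expect_scale ?invr_ge0 ?exprn_ge0//; last 2 first.
  - exact: measurable_weight_sum.
  - by move=> w; exact: sumr_ge0.
  rewrite expect_sum; last 2 first.
  - by move=> i; exact: meX.
  - by move=> i w.
  rewrite (eq_bigr (fun=> q'%:E)); last first.
    move=> i _; rewrite -Ee.
    have eE (Y : {mfun T >-> R}) : (\int[P]_w (e (Y w))%:E = \int[distribution P Y]_x (e x)%:E)%E.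
      by rewrite ge0_integral_distribution//; exact/measurable_EFinP.
    rewrite !eE; apply: eq_measure_integral => C mC _.
    by have [_ X_same] := X_iid; exact: X_same.
  rewrite sumEFin sumr_const cA -EFinM -mulr_natl; congr (_%:E).
  by field.
have E1 : (\int[P]_w (\1_E w)%:E = P E)%E by rewrite integral_indic// setIT.
rewrite EG E1.
apply: (@le_trans _ _ ((eta / 4)%:E + (c%:E + ((M%:R^-1 * q')%:E + (eta / 4)%:E)))%E).
  by apply: leeD => //; apply: leeD => //; apply: leeD.
by rewrite -!EFinD lee_fin /c; lra.
Qed.

End block_probabilities.

(** * The uniform limit *)

Lemma cvg_ereal_sup0 (R : realType) (S : nat -> set (\bar R)) :
  (forall eps : R, 0 < eps -> exists l0, forall l, (l0 <= l)%N ->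
     S l !=set0 /\ forall x, S l x -> (0 <= x <= eps%:E)%E) ->
  ereal_sup (S l) @[l --> \oo] --> 0%E.
Proof.
move=> H.
have sup_le eps : 0 < eps -> exists l0, forall l, (l0 <= l)%N ->
    (0 <= ereal_sup (S l) <= eps%:E)%E.
  move=> eps0; have [l0 Hl0] := H eps eps0; exists l0 => l l0l.
  have [[x Sx] Sle] := Hl0 l l0l; apply/andP; split.
    by have /andP[x0 _] := Sle x Sx; apply: (le_trans x0); exact: ereal_sup_ubound.
  by apply: ge_ereal_sup => y Sy; have /andP[] := Sle y Sy.
apply/fine_cvgP; split.
  have [l0 Hl0] := sup_le 1 ltr01; exists l0 => // l /= /Hl0 /andP[s0 s1].
  by rewrite ge0_fin_numE// (le_lt_trans s1)// ltry.
apply/cvgrPdist_le => eps eps0; have [l0 Hl0] := sup_le eps eps0.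
exists l0 => // l /= /Hl0 /andP[s0 s1]; rewrite sub0r normrN ger0_norm ?fine_ge0//.
by rewrite -lee_fin fineK// ge0_fin_numE// (le_lt_trans s1)// ltry.
Qed.

Lemma measurable_nneg (R : realType) : measurable [set x : R | 0 <= x].
Proof.
rewrite (_ : [set x | _] = `[0, +oo[%classic)//.
by apply/seteqP; split => x /=; rewrite in_itv/= andbT.
Qed.

Lemma measurable_clamp (R : realType) (g : R -> R) :
  measurable_fun [set x : R | 0 <= x] g ->
  measurable_fun [set: R] (fun x : R => g (Num.max x 0)).
Proof.
move=> mg; have mD := @measurable_nneg R.
apply: (measurable_comp mD) mg _; last first.
  by apply: measurable_maxr => //; exact: measurable_id.
by move=> _ [x _ <-] /=; rewrite le_max lexx orbT.
Qed.

Lemma measurable_clamp2 (R : realType) (g : R -> R -> R) :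
  measurable_fun [set z : R * R | 0 <= z.1 /\ 0 <= z.2] (fun z : R * R => g z.1 z.2) ->
  measurable_fun [set: R * R] (fun z : R * R => g (Num.max z.1 0) (Num.max z.2 0)).
Proof.
move=> mg; have mI := @measurable_nneg R.
have mD : measurable [set z : R * R | 0 <= z.1 /\ 0 <= z.2].
  rewrite (_ : [set z | _] = [set x : R | 0 <= x] `*` [set x : R | 0 <= x])//.
  exact: measurableX.
have mmax (p : R * R -> R) : measurable_fun [set: R * R] p ->
    measurable_fun [set: R * R] (fun z : R * R => Num.max (p z) 0).
  by move=> mp; apply: measurable_maxr.
pose clamp (z : R * R) := (Num.max z.1 0, Num.max z.2 0).
rewrite (_ : (fun z => _) = (fun z : R * R => g z.1 z.2) \o clamp)//.
apply: (measurable_comp mD) mg _; last first.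
  by apply/measurable_fun_pairP; split; apply: mmax.
by move=> _ [z _ <-] /=; rewrite !le_max !lexx !orbT.
Qed.

Theorem theorem1p4 (R : realType) (d : measure_display) (T : measurableType d)
    (P : probability T R)
    (m : nat) (m_ge2 : (2 <= m)%N)
    (* the fixed partitions: for graphs started on m^L vertices, blk L k is the
       partition of the m^(k+1) vertices into m^k groups of m vertices *)
    (blk : forall L k : nat, 'I_(m ^ k.+1) -> 'I_(m ^ k))
    (blk_card : forall L k (j : 'I_(m ^ k)),
       #|[set i : 'I_(m ^ k.+1) | blk L k i == j]%SET| = m)
    (X : nat -> {RV P >-> R}) (X' : {RV P >-> R})
    (X_ge0 : forall i w, 0 <= X i w)
    (X'_ge0 : forall w, 0 <= X' w)
    (X_iid : iid P (fun i => X i : T -> R))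
    (X'_indep : independent_pair P (X 0%N) X')
    (X'_distr : same_distribution P X' (X 0%N))
    (g_ne : R -> R -> R) (g_eq : R -> R)
    (g_ne_ge0 : forall x y : R, 0 <= x -> 0 <= y -> 0 <= g_ne x y)
    (g_ne_sym : forall x y : R, 0 <= x -> 0 <= y -> g_ne x y = g_ne y x)
    (g_ne_meas : measurable_fun [set z : R * R | 0 <= z.1 /\ 0 <= z.2]
       (fun z : R * R => g_ne z.1 z.2))
    (g_eq_ge0 : forall x : R, 0 <= x -> 0 <= g_eq x)
    (g_eq_meas : measurable_fun [set x : R | 0 <= x] g_eq)
    (E_g_ne : (0 < 'E_P[fun w => g_ne (X 0%N w) (X' w)] < +oo)%E)
    (E_g_eq : (0 <= 'E_P[fun w => g_eq (X 0%N w)] < +oo)%E)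
    (diag_cvg : cvg_in_probability P
       (fun k w => k%:R ^- 2 * \sum_(i < k) g_ne (X i w) (X i w))
       (fun _ => 0)) :
  let q_ne : R := fine ('E_P[fun w => g_ne (X 0%N w) (X' w)])%E in
  let q_eq : R := fine ('E_P[fun w => g_eq (X 0%N w)])%E in
  let p_ne : R := 1 - expR (- q_ne) in
  let p_eq : R := 1 - expR (- (2^-1 * (q_ne + q_eq))) in
  ereal_sup
    [set ('E_P[fun w => Delta
                (renormalised_irg_law (blk L) g_ne g_eq L l (fun i => X i w))
                (er_law (m ^ (L - l)) p_ne p_eq)])%E
    | L in [set L : nat | (l <= L)%N]] @[l --> \oo] --> 0%E.
Proof.
move=> q_ne q_eq p_ne p_eq.
have /andP[Ene_gt0 Ene_fin] := E_g_ne; have /andP[Eeq_ge0 Eeq_fin] := E_g_eq.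
have qneE : ('E_P[fun w => g_ne (X 0%N w) (X' w)] = q_ne%:E)%E.
  by rewrite fineK// ge0_fin_numE// ltW.
have qeqE : ('E_P[fun w => g_eq (X 0%N w)] = q_eq%:E)%E.
  by rewrite fineK// ge0_fin_numE.
have qne0 : 0 < q_ne by rewrite -lte_fin -qneE.
have qeq0 : 0 <= q_eq by rewrite -lee_fin -qeqE.
have pne01 : 0 < p_ne < 1 by exact: subr1_expRN_oitv.
have peq01 : 0 < p_eq < 1.
  by apply: subr1_expRN_oitv; rewrite mulr_gt0// ltr_pwDl.
(* Clamping the arguments at 0 makes the kernels total measurable functions
   without changing their values at the weights. *)
pose f (z : R * R) := g_ne (Num.max z.1 0) (Num.max z.2 0).
pose e (x : R) := g_eq (Num.max x 0).
have fE i j w : f (X i w, X j w) = g_ne (X i w) (X j w) by rewrite /f /= !max_l.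
have eE i w : e (X i w) = g_eq (X i w) by rewrite /e /= max_l.
have max0 (x : R) : 0 <= Num.max x 0 by rewrite le_max lexx orbT.
have mf : measurable_fun setT f by exact: measurable_clamp2.
have me : measurable_fun setT e by exact: measurable_clamp.
have f0 z : 0 <= f z by exact: g_ne_ge0.
have e0 x : 0 <= e x by exact: g_eq_ge0.
have X_iid' : iid P (fun i => (X i : {mfun T >-> R}) : T -> R) by exact: X_iid.
have [_ X_same] := X_iid'.
have Ef : (\int[P]_w (f (X 0%N w, X 1%N w))%:E = q_ne%:E)%E.
  rewrite -qneE unlock.
  rewrite (iid_pair_integral X_iid' (Y := X 0%N) (Z := X'))//.
  by apply: eq_integral => w _; rewrite /f /= !max_l.
have Ee : (\int[P]_w (e (X 0%N w))%:E = q_eq%:E)%E.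
  by rewrite -qeqE unlock; apply: eq_integral => w _; rewrite eE.
have diag : cvg_in_probability P
    (fun k w => k%:R ^- 2 * \sum_(i < k) f (X i w, X i w)) (fun _ => 0).
  move=> eps eps0; have := diag_cvg eps eps0.
  by under eq_fun do under eq_set do under eq_bigr do rewrite -fE.
apply: cvg_ereal_sup0 => eps eps0.
set c := (p_ne * (1 - p_ne))^-1 + (p_eq * (1 - p_eq))^-1.
have c0 : 0 < c.
  move: pne01 peq01 => /andP[? ?] /andP[? ?].
  by rewrite addr_gt0// invr_gt0 mulr_gt0// subr_gt0.
have eta0 : 0 < eps / c by rewrite divr_gt0.
have [M1 edge_small] := edge_prob_L1 X_iid' mf f0 Ef eta0.
have [M2 loop_small] := loop_prob_L1 X_iid' mf f0 Ef me e0 Ee diag eta0.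
(* Blocks of level [l] have [m ^ l > l] elements. *)
exists (maxn M1 M2) => l; rewrite geq_max => /andP[M1l M2l].
split; first by eexists; exists l => //=; exact: leqnn.
move=> _ [L /= lL <-].
have M1M : (M1 <= m ^ l)%N by rewrite (leq_trans M1l)// ltnW// ltn_expl.
have M2M : (M2 <= m ^ l)%N by rewrite (leq_trans M2l)// ltnW// ltn_expl.
have [pi [pi_card piP]] := edge_prob_renormalised R (blk_card L) lL.
pose A a : {set 'I_(m ^ L)} := [set i | pi i == a]%SET.
have gC w i j : g_ne (X i w) (X j w) = g_ne (X j w) (X i w) by exact: g_ne_sym.
pose Y a b w := (m ^ l)%:R ^- 2 * \sum_(i in A a) \sum_(j in A b) f (X i w, X j w).
pose Z a w := 2^-1 * ((m ^ l)%:R ^- 2 * \sum_(i in A a) \sum_(j in A a) f (X i w, X j w)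
                      + (m ^ l)%:R^-1 * \sum_(i in A a) e (X i w)).
pose mu w := renormalised_irg_law (blk L) g_ne g_eq L l (fun i => X i w).
have muE w a b : edge_prob (mu w) a b =
    if a == b then 1 - expR (- Z a w) else 1 - expR (- Y a b w).
  have sumE a' b' : \sum_(i | pi i == a') \sum_(j | pi j == b') g_ne (X i w) (X j w) =
      \sum_(i in A a') \sum_(j in A b') f (X i w, X j w).
    apply: eq_big => [i|i _]; first by rewrite inE.
    by apply: eq_big => [j|j _]; rewrite ?inE ?fE.
  have sumE' a' : \sum_(i | pi i == a') g_eq (X i w) = \sum_(i in A a') e (X i w).
    by apply: eq_big => [i|i _]; rewrite ?inE ?eE.
  rewrite /mu (piP _ _ (fun i => X i w))//.
  by rewrite /Y /Z -!natrX -!expnM mulnC !sumE sumE'.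
have mY a b : measurable_fun setT (Y a b).
  by apply: measurable_funM => //; exact: measurable_kernel_sum.
have mZ a : measurable_fun setT (Z a).
  apply: measurable_funM => //; apply: measurable_funD; apply: measurable_funM => //.
    exact: measurable_kernel_sum.
  exact: measurable_weight_sum.
have Y0 a b w : 0 <= Y a b w.
  by rewrite mulr_ge0 ?invr_ge0 ?exprn_ge0//; do 2!apply: sumr_ge0 => ? _.
have Z0 a w : 0 <= Z a w.
  rewrite mulr_ge0// addr_ge0// mulr_ge0 ?invr_ge0 ?exprn_ge0//; apply: sumr_ge0 => // i _.
  exact: sumr_ge0.
have dist (x y : R) : `|1 - expR (- x) - (1 - expR (- y))| = `|expR (- x) - expR (- y)|.
  by rewrite opprB addrC addrA subrK distrC.
have mexp (F : T -> R) : measurable_fun setT F -> measurable_fun setT (fun w => 1 - expR (- F w)).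
  move=> mF; apply: measurable_funB => //.
  apply: (measurableT_comp (@measurable_expR R)).
  exact: (measurableT_comp (@oppr_measurable R _)).
have -> : eps = c * (eps / c) by rewrite mulrC divfK ?gt_eqF.
apply: (@expect_Delta_le _ _ _ _ _ mu) => //; first exact: ltW.
- move=> a b; have [->|ab] := eqVneq a b.
    rewrite (_ : (fun w => _) = fun w => 1 - expR (- Z b w)); first exact: mexp.
    by apply/funext => w; rewrite muE eqxx.
  rewrite (_ : (fun w => _) = fun w => 1 - expR (- Y a b w)); first exact: mexp.
  by apply/funext => w; rewrite muE (negbTE ab).
- by move=> a b w; rewrite muE; case: ifP => _; exact: subr1_expRN_itv.
- move=> a b ab; under eq_integral do rewrite muE (negbTE ab) dist.
  apply: edge_small => // [||i]; try exact: pi_card.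
  by rewrite !inE => /eqP -> /eqP E; rewrite E eqxx in ab.
- move=> a; under eq_integral do rewrite muE eqxx dist.
  by apply: loop_small => //; exact: pi_card.
Qed.
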